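(* Let $T$ be a complete first-order theory with monster model $\mathcal{U}$. Then $T$ admits a stable ict-pattern if and only if there are generically stable types $p\in S_x(\mathcal{U})$ and $q\in S_y(\mathcal{U})$ such that $p\otimes q$ is not generically stable.
   Context: A sequence $(a_i)_{i<\omega}$ in $\mathcal{U}^x$ is stable if for every $\mathcal{L}$-formula $\varphi(x,y)$ there is $n$ such that for every $b\in\mathcal{U}^y$, either $|\{i:\mathcal{U}\models\varphi(a_i,b)\}|\le n$ or $|\{i:\mathcal{U}\models\neg\varphi(a_i,b)\}|\le n$. A stable ict-pattern consists of a formula $\varphi(x,y,z)$ and stable sequences $(a_i)_{i<\omega}$ in $\mathcal{U}^x$ and $(b_i)_{i<\omega}$ in $\mathcal{U}^y$ such that for every bijection $f\colon\omega\to\omega$, the set $\{\varphi(a_i,b_j,z)^{\text{if } f(i)=j}:i,j<\omega\}$ is consistent (where $\varphi^{\text{true}}=\varphi$ and $\varphi^{\text{false}}=\neg\varphi$). For a global type $p$ invariant over a small $M\prec\mathcal{U}$, a Morley sequence in $p$ over $M$ is $(a_i)_{i<\omega}$ with $a_i\models p|_{Ma_{<i}}$; $p$ is generically stable over $M$ if for every Morley sequence $(a_i)$ in $p$ over $M$, $\lim_i\operatorname{tp}(a_i/\mathcal{U})=p$; $p$ is generically stable if it is generically stable over some small $M$ over which it is invariant. For invariant global types $p(x),q(y)$, $p\otimes q$ is the global type of $(a,b)$ where $b\models q$ and $a\models p|_{\mathcal{U}b}$. *)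

(* Defs.v *)
(* MathComp, with the classical layer of MathComp-Analysis. *)
From mathcomp Require Import all_boot all_classical.

Set Implicit Arguments.
Unset Strict Implicit.
Unset Printing Implicit Defensive.

Local Open Scope classical_set_scope.
Local Open Scope card_scope.

(** * One-sorted first-order logic *)

Record language := Language {
  fsym : Type;
  rsym : Type;
  farity : fsym -> nat;
  rarity : rsym -> nat }.

Inductive term (L : language) (V : Type) : Type :=
| Var of V
| App (f : fsym L) of ('I_(farity f) -> term L V).

(* [formula L V] consists of the formulas whose free variables lie in [V]; in
   [All], the bound variable is [None].  A tuple of variables x is a finite type
   [X], and U^x is [X -> U].  A formula phi(x,y) has type [formula L (X + Y)];
   an L(U)-formula in x has type [formula L (X + U)], each parameter being a
   free variable that is always interpreted by itself. *)
Inductive formula (L : language) (V : Type) : Type :=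
| Bot
| Eq of term L V & term L V
| Rel (r : rsym L) of ('I_(rarity r) -> term L V)
| Imp of formula L V & formula L V
| All of formula L (option V).

Arguments Var {L V}.
Arguments App {L V}.
Arguments Bot {L V}.
Arguments Eq {L V}.
Arguments Rel {L V}.
Arguments Imp {L V}.
Arguments All {L V}.

Definition Neg L V (phi : formula L V) : formula L V := Imp phi Bot.

Fixpoint term_map L V W (g : V -> W) (t : term L V) : term L W :=
  match t with
  | Var v => Var (g v)
  | App f ts => App f (fun i => term_map g (ts i))
  end.

Fixpoint formula_map L V W (g : V -> W) (phi : formula L V) : formula L W :=
  match phi with
  | Bot => Bot
  | Eq s t => Eq (term_map g s) (term_map g t)
  | Rel r ts => Rel r (fun i => term_map g (ts i))
  | Imp phi psi => Imp (formula_map g phi) (formula_map g psi)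
  | All phi => All (formula_map (omap g) phi)
  end.

Record structure (L : language) := Structure {
  carrier :> Type;
  carrier_inhabited : inhabited carrier;
  fint : forall f : fsym L, ('I_(farity f) -> carrier) -> carrier;
  rint : forall r : rsym L, ('I_(rarity r) -> carrier) -> Prop }.

Fixpoint eval L (M : structure L) V (v : V -> M) (t : term L V) : M :=
  match t with
  | Var x => v x
  | App f ts => fint (fun i => eval v (ts i))
  end.

Fixpoint sat L (M : structure L) V (v : V -> M) (phi : formula L V) : Prop :=
  match phi with
  | Bot => False
  | Eq s t => eval v s = eval v t
  | Rel r ts => rint (fun i => eval v (ts i))
  | Imp phi psi => sat v phi -> sat v psi
  | All phi => forall a : M, sat (fun o => if o is Some x then v x else a) phi
  end.

Definition vcat X Y A (a : X -> A) (b : Y -> A) (z : X + Y) : A :=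
  match z with inl x => a x | inr y => b y end.

Definition sentence L := formula L void.

Definition models L (M : structure L) (T : set (sentence L)) : Prop :=
  forall s, T s -> sat (of_void M) s.

Definition entails L (T : set (sentence L)) (s : sentence L) : Prop :=
  forall M : structure L, models M T -> sat (of_void M) s.

Definition complete_theory L (T : set (sentence L)) : Prop :=
  (exists M : structure L, models M T) /\
  (forall s, entails T s \/ entails T (Neg s)).

Definition elementary L (M N : structure L) (h : M -> N) : Prop :=
  forall (X : finType) (phi : formula L X) (a : X -> M),
    sat a phi <-> sat (h \o a) phi.

Definition induced L (U : structure L) (M : set U) (M0 : inhabited M)
    (clM : forall (f : fsym L) (a : 'I_(farity f) -> M),
             M (fint (fun i => set_val (a i)))) : structure L :=
  @Structure L M M0
    (fun f a => SigSub (mem_set (clM f a)))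
    (fun r a => rint (fun i => set_val (a i))).

Definition elementary_substructure L (U : structure L) (M : set U) : Prop :=
  exists M0 clM, elementary (fun a : @induced L U M M0 clM => set_val a : U).

Definition automorphism L (U : structure L) (s : U -> U) : Prop :=
  [/\ bijective s,
      forall (f : fsym L) (a : 'I_(farity f) -> U),
        s (fint a) = fint (s \o a)
    & forall (r : rsym L) (a : 'I_(rarity r) -> U),
        rint a <-> rint (s \o a)].

(** * Types and monster models *)

Definition inst L (U : structure L) (X Y : Type) (phi : formula L (X + Y))
    (b : Y -> U) : formula L (X + U) :=
  formula_map (vcat inl (inr \o b)) phi.

(* The L(A)-formulas in the variables x. *)
Definition params_in L (U : structure L) (X : finType) (A : set U) :
    set (formula L (X + U)) :=
  [set psi | exists (Y : finType) (phi : formula L (X + Y)) (b : Y -> U),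
     (forall y, A (b y)) /\ psi = inst phi b].

Definition fin_sat L (U : structure L) (X : Type)
    (S : set (formula L (X + U))) : Prop :=
  forall (k : nat) (F : 'I_k -> formula L (X + U)), (forall i, S (F i)) ->
    exists a : X -> U, forall i, sat (vcat a id) (F i).

(* S_x(U) *)
Definition global_type L (U : structure L) (X : finType)
    (p : set (formula L (X + U))) : Prop :=
  fin_sat p /\ forall phi, p phi \/ p (Neg phi).

(* |A| < |K| *)
Definition card_lt (K V : Type) (A : set V) : Prop := ~ ([set: K] #<= A).

(* The cardinal kappa is given by a type [K] of that cardinality: [U] is
   kappa-saturated and strongly kappa-homogeneous, where kappa > |T|, and the
   small subsets of [U] are those of cardinality < kappa.  Here |T| is the number
   of L-formulas, i.e. |L| + aleph_0. *)
Definition saturated (K : Type) L (U : structure L) : Prop :=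
  forall (A : set U) (X : finType) (S : set (formula L (X + U))),
    card_lt K A -> S `<=` params_in A -> fin_sat S ->
    exists a : X -> U, forall phi, S phi -> sat (vcat a id) phi.

Definition strongly_homogeneous (K : Type) L (U : structure L) : Prop :=
  forall (A : set U) (f : U -> U), card_lt K A ->
    (forall (X : finType) (phi : formula L X) (a : X -> U),
       (forall x, A (a x)) -> (sat a phi <-> sat (f \o a) phi)) ->
    exists2 s, automorphism s & forall a, A a -> s a = f a.

Definition monster (K : Type) L (T : set (sentence L)) (U : structure L) :
    Prop :=
  [/\ models U T, card_lt K [set: formula L nat], saturated K U
    & strongly_homogeneous K U].

Definition small_model (K : Type) L (U : structure L) (M : set U) : Prop :=
  card_lt K M /\ elementary_substructure M.

(** * Generic stability *)

(* For h : U -> N elementary: tp(b/M) = tp(d/M), with b in U and d in N. *)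
Definition same_type L (U N : structure L) (h : U -> N) (M : set U)
    (X : finType) (b : X -> U) (d : X -> N) : Prop :=
  forall (Y : finType) (phi : formula L (X + Y)) (c : Y -> U),
    (forall y, M (c y)) -> (sat (vcat b c) phi <-> sat (vcat d (h \o c)) phi).

Definition invariant L (U : structure L) (X : finType) (M : set U)
    (p : set (formula L (X + U))) : Prop :=
  forall (Y : finType) (phi : formula L (X + Y)) (b b' : Y -> U),
    same_type id M b b' -> (p (inst phi b) <-> p (inst phi b')).

(* a |= p|_A *)
Definition realizes L (U : structure L) (X : finType) (A : set U)
    (p : set (formula L (X + U))) (a : X -> U) : Prop :=
  forall phi, p phi -> params_in A phi -> sat (vcat a id) phi.

Definition Morley_sequence L (U : structure L) (X : finType) (M : set U)
    (p : set (formula L (X + U))) (a : nat -> X -> U) : Prop :=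
  forall i,
    realizes (M `|` [set u | exists2 j, (j < i)%N & exists x, u = a j x])
      p (a i).

(* lim_i tp(a_i/U) = p *)
Definition lim_type L (U : structure L) (X : finType) (a : nat -> X -> U)
    (p : set (formula L (X + U))) : Prop :=
  forall phi, p phi ->
    exists k, forall i, (k <= i)%N -> sat (vcat (a i) id) phi.

Definition generically_stable_over L (U : structure L) (X : finType)
    (M : set U) (p : set (formula L (X + U))) : Prop :=
  forall a, Morley_sequence M p a -> lim_type a p.

Definition generically_stable (K : Type) L (U : structure L) (X : finType)
    (p : set (formula L (X + U))) : Prop :=
  exists M : set U,
    [/\ small_model K M, invariant M p & generically_stable_over M p].

(* a |= p|_B, for an elementary map h : U -> N, a subset B of N and an invariant
   global type p.  Here p|_B is the canonical extension of p: when p is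
   M-invariant, it consists of the formulas phi(x,d) with d in B such that
   phi(x,d') is in p for d' in U with the same type over M as d.  It does not
   depend on the choice of M and d'. *)
Definition realizes_ext (K : Type) L (U N : structure L) (h : U -> N)
    (X : finType) (B : set N) (p : set (formula L (X + U))) (a : X -> N) :
    Prop :=
  exists M : set U, [/\ small_model K M, invariant M p
    & forall (Y : finType) (phi : formula L (X + Y)) (d : Y -> N) (d' : Y -> U),
        (forall y, B (d y)) -> same_type h M d' d ->
        p (inst phi d') -> sat (vcat a d) phi].

(* p (x) q = tp(a,b/U), where b |= q and a |= p|_{Ub} in some elementary
   extension h : U -> N. *)
Definition tensor (K : Type) L (U : structure L) (X Y : finType)
    (p : set (formula L (X + U))) (q : set (formula L (Y + U))) :
    set (formula L ((X + Y)%type + U)) :=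
  [set phi | exists (N : structure L) (h : U -> N) (a : X -> N) (b : Y -> N),
     [/\ elementary h,
         forall psi, q psi -> sat (vcat b h) psi,
         realizes_ext K h (range h `|` range b) p a
       & sat (vcat (vcat a b) h) phi]].

(** * Stable ict-patterns *)

Definition stable_sequence L (U : structure L) (X : finType)
    (a : nat -> X -> U) : Prop :=
  forall (Y : finType) (phi : formula L (X + Y)),
    exists n : nat, forall b : Y -> U,
      [set i | sat (vcat (a i) b) phi] #<= `I_n \/
      [set i | ~ sat (vcat (a i) b) phi] #<= `I_n.

(* phi(a,b,z), as an L(U)-formula in z *)
Definition inst_xy L (U : structure L) (X Y Z : finType)
    (phi : formula L ((X + Y)%type + Z)) (a : X -> U) (b : Y -> U) :
    formula L (Z + U) :=
  formula_map (vcat (inr \o vcat a b) inl) phi.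

Definition stable_ict_pattern L (U : structure L) (X Y Z : finType)
    (phi : formula L ((X + Y)%type + Z))
    (a : nat -> X -> U) (b : nat -> Y -> U) : Prop :=
  [/\ stable_sequence a, stable_sequence b
    & forall f : nat -> nat, bijective f ->
        fin_sat [set psi | exists i j : nat,
          psi = (if f i == j then inst_xy phi (a i) (b j)
                 else Neg (inst_xy phi (a i) (b j)))]].

Definition admits_stable_ict_pattern L (U : structure L) : Prop :=
  exists (X Y Z : finType) (phi : formula L ((X + Y)%type + Z))
    (a : nat -> X -> U) (b : nat -> Y -> U), stable_ict_pattern phi a b.

(* Main.v *)
(** Both sides are reduced to stable sequences.  The limit of a stable sequence
    is definable by a majority vote among its first terms, hence is a
    generically stable type; conversely a Morley sequence of a generically
    stable type p is stable, since otherwise compactness yields two Morley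
    sequences, both converging to p, separated by a formula.  So let p and q be
    the limits of stable sequences (a_i) and (b_j).  By an ultrapower
    construction, p (x) q consists of the formulas phi such that, for all large
    j and then all large i, phi(a_i,b_j) holds.

    Given a stable ict-pattern phi, (a_i), (b_j), let (c_i,d_i) be a Morley
    sequence of p (x) q over a set containing all a_i and b_j.  Approximating
    its terms, starting from the last one, by pairs (a_i,b_j) with distinct
    indices, one gets z such that phi(c_i,d_j,z) holds iff i = j.  If p (x) q
    were generically stable, phi(x,y,z) would belong to it, hence would hold of
    (c_i,d_j) for all large j and then all large i.

    Conversely, if a Morley sequence (c_i,d_i) of p (x) q does not converge to
    it, some formula of p (x) q fails at infinitely many (c_i,d_i); after
    extracting a subsequence it holds of (c_i,d_j) exactly when i <> j.  The
    generic quantifiers of p and q commute with themselves and with each other,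
    so the type of (c_i), (d_j) does not change when the d_j are permuted, and
    the negation of the formula gives a stable ict-pattern. *)

Require Import Defs.
From mathcomp Require Import all_boot all_classical.
From mathcomp Require Import zify.

Set Implicit Arguments.
Unset Strict Implicit.
Unset Printing Implicit Defensive.

Local Open Scope classical_set_scope.
Local Open Scope card_scope.

(** * Definable relations *)

Lemma dep_choice (I : Type) (T : I -> Type) (P : forall i, T i -> Prop) :
  (forall i, exists x, P i x) -> exists f : forall i, T i, forall i, P i (f i).
Proof.
by move=> H; exists (fun i => projT1 (cid (H i))) => i; case: (cid (H i)).
Qed.

(** * Renaming of variables and finite supports of formulas *)

Section Syntax.
Variable L : language.

Lemma term_map_comp (V W Z : Type) (g : V -> W) (h : W -> Z) (t : term L V) :
  term_map h (term_map g t) = term_map (h \o g) t.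
Proof. by elim: t => //= f ts IH; congr App; apply/funext => i. Qed.

Lemma omap_comp_fun (V W Z : Type) (g : V -> W) (h : W -> Z) :
  omap h \o omap g = omap (h \o g).
Proof. by apply/funext; case. Qed.

Lemma formula_map_comp (V W Z : Type) (g : V -> W) (h : W -> Z)
    (phi : formula L V) :
  formula_map h (formula_map g phi) = formula_map (h \o g) phi.
Proof.
elim: phi W Z g h => //= {V}.
- by move=> V s t W Z g h; rewrite !term_map_comp.
- by move=> V r ts W Z g h; congr Rel; apply/funext => i; rewrite term_map_comp.
- by move=> V phi IHp psi IHq W Z g h; rewrite IHp IHq.
- by move=> V phi IH W Z g h; rewrite IH omap_comp_fun.
Qed.

Lemma eval_map (M : structure L) (V W : Type) (g : V -> W) (v : W -> M)
    (t : term L V) :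
  eval v (term_map g t) = eval (v \o g) t.
Proof. by elim: t => //= f ts IH; congr fint; apply/funext => i. Qed.

Lemma sat_map (M : structure L) (V W : Type) (g : V -> W) (v : W -> M)
    (phi : formula L V) :
  sat v (formula_map g phi) = sat (v \o g) phi.
Proof.
elim: phi W g v => //= {V}.
- by move=> V s t W g v; rewrite !eval_map.
- by move=> V r ts W g v; congr rint; apply/funext => i; rewrite eval_map.
- by move=> V phi IHp psi IHq W g v; rewrite IHp IHq.
- move=> V phi IH W g v; apply: eq_forall => a; rewrite IH.
  by congr sat; apply/funext; case.
Qed.

(** Arities are finite, so only finitely many variables occur. Each occurrence of a variable sent to
    [Z] gets its own element of [Y]; hence [c] need not be injective, and the supports of several
    arguments are simply put side by side. *)
Lemma term_support (V X Z : Type) (g : V -> X + Z) (t : term L V) :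
  exists (Y : finType) (c : Y -> Z) (t0 : term L (X + Y)),
    term_map g t = term_map (vcat inl (inr \o c)) t0.
Proof.
elim: t => [v|f ts IH] /=.
- case E : (g v) => [x|z].
  + by exists void, (of_void Z), (Var (inl x)).
  + by exists unit, (fun=> z), (Var (inr tt)).
- have [Y /dep_choice [c /dep_choice [t0 H]]] := choice IH.
  exists {i & Y i}, (fun s => c (tag s) (tagged s)).
  exists (App f (fun i => term_map
    (fun v : X + Y i => match v with inl x => inl x
      | inr y => inr (Tagged Y y) end) (t0 i))) => /=.
  congr App; apply/funext => i; rewrite H term_map_comp.
  by congr term_map; apply/funext; case.
Qed.

Lemma formula_support_map (V X Z : Type) (g : V -> X + Z) (phi : formula L V) :
  exists (Y : finType) (c : Y -> Z) (phi0 : formula L (X + Y)),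
    formula_map g phi = formula_map (vcat inl (inr \o c)) phi0.
Proof.
elim: phi X Z g => {V} /=.
- by move=> V X Z g; exists void, (of_void Z), Bot.
- move=> V s t X Z g.
  have [Y [c [s0 ->]]] := term_support g s.
  have [Y' [c' [t0 ->]]] := term_support g t.
  exists (Y + Y')%type, (vcat c c').
  exists (Eq (term_map (fun v => match v with inl x => inl x
     | inr y => inr (inl y) end) s0) (term_map (fun v => match v with
     inl x => inl x | inr y => inr (inr y) end) t0)) => /=.
  by rewrite !term_map_comp; congr Eq; congr term_map; apply/funext; case.
- move=> V r ts X Z g.
  have [Y /dep_choice [c /dep_choice [t0 H]]] :=
    choice (fun i => term_support g (ts i)).
  exists {i & Y i}, (fun s => c (tag s) (tagged s)).
  exists (Rel r (fun i => term_map
    (fun v : X + Y i => match v with inl x => inl x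
      | inr y => inr (Tagged Y y) end) (t0 i))) => /=.
  congr Rel; apply/funext => i; rewrite H term_map_comp.
  by congr term_map; apply/funext; case.
- move=> V phi IHp psi IHq X Z g.
  have [Y [c [s0 ->]]] := IHp X Z g.
  have [Y' [c' [t0 ->]]] := IHq X Z g.
  exists (Y + Y')%type, (vcat c c').
  exists (Imp (formula_map (fun v => match v with inl x => inl x
     | inr y => inr (inl y) end) s0) (formula_map (fun v => match v with
     inl x => inl x | inr y => inr (inr y) end) t0)) => /=.
  by rewrite !formula_map_comp; congr Imp; congr formula_map; apply/funext; case.
- move=> V phi IH X Z g.
  (* The bound variable is put on the [X] side, so it is never abstracted as an element of [Y]. The
     freedom to vary [g] and [X] in the induction serves this case. *)
  pose g' (o : option V) : option X + Z :=
    if o is Some v then match g v with inl x => inl (Some x) | inr z => inr z end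
    else inl None.
  have [Y [c [phi0 E]]] := IH _ _ g'.
  exists Y, c.
  pose r Y' (o : option X + Y') : option (X + Y') := match o with
     inl x => omap inl x | inr y => Some (inr y) end.
  exists (All (formula_map (r Y) phi0)) => /=.
  have -> : omap g = r Z \o g'.
    by apply/funext => -[v|] //=; case: (g v).
  rewrite -formula_map_comp E !formula_map_comp; congr (All (formula_map _ _)).
  by apply/funext => -[[x|]|y].
Qed.

Lemma formula_map_id (V : Type) (phi : formula L V) : formula_map id phi = phi.
Proof.
have term_id V' (t : term L V') : term_map id t = t.
  by elim: t => //= f ts IH; congr App; apply/funext.
elim: phi => //= {V}.
- by move=> V s t; rewrite !term_id.
- by move=> V r ts; congr Rel; apply/funext => i; rewrite term_id.
- by move=> V phi -> psi ->.
- move=> V phi {2}<-; congr (All (formula_map _ _)).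
  by apply/funext; case.
Qed.

Lemma formula_support (X Z : Type) (phi : formula L (X + Z)) :
  exists (Y : finType) (c : Y -> Z) (phi0 : formula L (X + Y)),
    phi = formula_map (vcat inl (inr \o c)) phi0.
Proof. by have := formula_support_map id phi; rewrite formula_map_id. Qed.

Lemma sat_inst (U : structure L) (X Y : Type) (phi : formula L (X + Y))
    (b : Y -> U) (a : X -> U) :
  sat (vcat a id) (inst phi b) = sat (vcat a b) phi.
Proof. by rewrite sat_map; congr sat; apply/funext; case. Qed.

Lemma inst_support (U : structure L) (X : Type) (phi : formula L (X + U)) :
  exists (Y : finType) (c : Y -> U) (phi0 : formula L (X + Y)),
    phi = inst phi0 c.
Proof. exact: formula_support. Qed.

End Syntax.

Lemma eq_iff (T : Type) (P : T -> Prop) (x y : T) : x = y -> P x <-> P y.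
Proof. by move->. Qed.

Lemma iff_forall (T : Type) (P Q : T -> Prop) :
  (forall x, P x <-> Q x) -> (forall x, P x) <-> (forall x, Q x).
Proof. by move=> H; split=> h x; apply/H. Qed.

Lemma not_forallNE (T : Type) (P : T -> Prop) :
  ~ (forall x, ~ P x) <-> exists x, P x.
Proof.
split; last by move=> [x p] h; exact: h p.
move=> h.
by apply: contrapT => n; apply: h => x p; apply: n; exists x.
Qed.

(** * Relations definable with parameters, closed under the logical operations *)

Section Definable.
Variables (L : language) (U : structure L).
Implicit Types (A B : set U).

(** The variables may form an infinite type, such as [nat * W] for a sequence of tuples, and the
    parameters are extra variables ranging over the subtype of [A]. *)
Definition definable A (V : Type) (P : (V -> U) -> Prop) :=
  exists phi : formula L (V + {u | A u}),
    forall v, sat (vcat v sval) phi <-> P v.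

Lemma eq_definable A V (P Q : (V -> U) -> Prop) :
  (forall v, P v <-> Q v) -> definable A P -> definable A Q.
Proof. by move=> E [phi H]; exists phi => v; rewrite H. Qed.

Lemma definable_subset A B V (P : (V -> U) -> Prop) :
  A `<=` B -> definable A P -> definable B P.
Proof.
move=> AB [phi H].
exists (formula_map (fun x => match x with inl v => inl v
  | inr a => inr (exist _ (sval a) (AB _ (svalP a))) end) phi) => v.
rewrite -H sat_map; apply: (eq_iff (fun w => sat w phi)); by apply/funext; case.
Qed.

Lemma definable_bot A V : definable A (fun _ : V -> U => False).
Proof. by exists Bot. Qed.

Lemma definable_imp A V (P Q : (V -> U) -> Prop) :
  definable A P -> definable A Q -> definable A (fun v => P v -> Q v).
Proof.
by move=> [phi H] [psi H']; exists (Imp phi psi) => v /=; rewrite H H'.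
Qed.

Lemma definable_not A V (P : (V -> U) -> Prop) :
  definable A P -> definable A (fun v => ~ P v).
Proof. by move=> H; apply: definable_imp => //; apply: definable_bot. Qed.

Lemma definable_and A V (P Q : (V -> U) -> Prop) :
  definable A P -> definable A Q -> definable A (fun v => P v /\ Q v).
Proof.
move=> HP /definable_not HQ.
apply: eq_definable (definable_not (definable_imp HP HQ)) => v.
by split=> [|[p q] /(_ p)//]; rewrite not_implyE notK.
Qed.

Lemma definable_iff A V (P Q : (V -> U) -> Prop) :
  definable A P -> definable A Q -> definable A (fun v => P v <-> Q v).
Proof. by move=> HP HQ; apply: definable_and; apply: definable_imp. Qed.

Lemma definable_const A V (Q : Prop) : definable A (fun _ : V -> U => Q).
Proof.
case: (EM Q) => q.
  apply: eq_definable (definable_not (definable_bot A V)) => _; split=> // _ [].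
by apply: eq_definable (definable_bot A V) => _.
Qed.

Lemma definable_forall A V (I : finType) (P : I -> (V -> U) -> Prop) :
  (forall i, definable A (P i)) -> definable A (fun v => forall i, P i v).
Proof.
move=> H; suff D (s : seq I) : definable A (fun v => forall i, i \in s -> P i v).
  apply: eq_definable (D (enum I)) => v; split=> h i; last by [].
  by apply: h; rewrite mem_enum.
elim: s => [|i s IH]; first by apply: eq_definable (definable_const A V True).
apply: eq_definable (definable_and (H i) IH) => v; split.
  by move=> [h h'] j; rewrite inE => /orP[/eqP->|/h'].
by move=> h; split=> [|j js]; apply: h; rewrite inE ?eqxx ?js ?orbT.
Qed.

Lemma definable_exists A V (I : finType) (P : I -> (V -> U) -> Prop) :
  (forall i, definable A (P i)) -> definable A (fun v => exists i, P i v).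
Proof.
move=> H; apply: eq_definable
  (definable_not (definable_forall (fun i => definable_not (H i)))) => v.
exact: not_forallNE.
Qed.

(** A condition on a finite truth pattern is a finite disjunction over the patterns that satisfy it.
    This expresses the majority vote that defines a limit type. *)
Lemma definable_bool A V (I : finType) (P : I -> (V -> U) -> Prop)
    (F : {set I} -> Prop) :
  (forall i, definable A (P i)) ->
  definable A (fun v => F [set i | `[<P i v>]]%SET).
Proof.
move=> H; pose S := (fun s v => F s /\ forall i, i \in s <-> P i v).
have D : definable A (fun v => exists s, S s v).
  apply: definable_exists => s; apply: definable_and (definable_const _ _ _) _.
  by apply: definable_forall => i; apply: definable_iff => //; apply: definable_const.
apply: eq_definable D => v; split.
  move=> [s [Fs E]]; suff <- : s = [set i | `[<P i v>]]%SET by [].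
  by apply/setP => i; rewrite inE; apply/idP/asboolP => /E.
move=> h; exists [set i | `[<P i v>]]%SET; split=> // i; rewrite inE.
by split=> /asboolP.
Qed.

Lemma definable_subst A V W (g : V -> W + {u | A u}) (P : (V -> U) -> Prop) :
  definable A P -> definable A (fun w => P (vcat w sval \o g)).
Proof.
move=> [phi H].
exists (formula_map (vcat g inr) phi) => w; rewrite -H sat_map.
suff -> : vcat w sval \o vcat g inr = vcat (vcat w sval \o g) sval by [].
by apply/funext; case.
Qed.

Lemma definable_rename A V W (g : V -> W) (P : (V -> U) -> Prop) :
  definable A P -> definable A (fun w => P (w \o g)).
Proof. exact: (@definable_subst A V W (inl \o g)). Qed.

Lemma definable_fix A V W (c : W -> U) (P : (V + W -> U) -> Prop) :
  (forall w, A (c w)) -> definable A P -> definable A (fun v => P (vcat v c)).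
Proof.
move=> cA D.
apply: eq_definable (definable_subst
   (vcat inl (fun w => inr (exist _ (c w) (cA w)))) D) => v.
suff -> : vcat v sval \o vcat inl (fun w => inr (exist _ (c w) (cA w))) =
  vcat v c by []; by apply/funext; case.
Qed.

Lemma definable_all1 A V (P : (option V -> U) -> Prop) : definable A P ->
  definable A (fun v => forall a, P (fun o => if o is Some x then v x else a)).
Proof.
move=> [phi H].
exists (All (formula_map (fun x => match x with inl (Some v) => Some (inl v)
  | inl None => None | inr u => Some (inr u) end) phi)) => v /=.
apply: iff_forall => a; rewrite -H sat_map.
apply: (eq_iff (fun w => sat w phi)); by apply/funext; case=> [[]|].
Qed.

Lemma definable_ex1 A V (P : (option V -> U) -> Prop) : definable A P ->
  definable A (fun v => exists a, P (fun o => if o is Some x then v x else a)).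
Proof.
move=> /definable_not/definable_all1/definable_not; apply: eq_definable => v.
exact: not_forallNE.
Qed.

Lemma definable_support A V Z (P : (V + Z -> U) -> Prop) : definable A P ->
  exists (Y : finType) (c : Y -> Z) (Q : (V + Y -> U) -> Prop),
    definable A Q /\ forall v z, P (vcat v z) <-> Q (vcat v (z \o c)).
Proof.
move=> [phi H].
have [Y [c [phi0 E]]] := formula_support_map (fun x : V + Z + {u | A u} =>
   match x with inl (inl v) => inl (inl v) | inr a => inl (inr a)
   | inl (inr z) => inr z end) phi.
exists Y, c, (fun w => sat (vcat w sval) (formula_map
   (fun x : V + {u | A u} + Y => match x with inl (inl v) => inl (inl v)
     | inl (inr a) => inr a | inr y => inl (inr y) end) phi0)).
split; first by eexists=> w; exact: iff_refl.
move=> v z; rewrite -H.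
have -> : sat (vcat (vcat v z) sval) phi <->
  sat (vcat (vcat v sval) z) (formula_map (fun x : V + Z + {u | A u} =>
   match x with inl (inl v) => inl (inl v) | inr a => inl (inr a)
   | inl (inr z) => inr z end) phi).
  rewrite sat_map; apply: (eq_iff (fun w => sat w phi)); by apply/funext; case=> [[]|].
rewrite E !sat_map; apply: (eq_iff (fun w => sat w phi0)); by apply/funext; case=> [[]|].
Qed.

Lemma definable_ex_ord A V n (P : (V + 'I_n -> U) -> Prop) : definable A P ->
  definable A (fun v => exists a, P (vcat v a)).
Proof.
elim: n V P => [|n IH] V P D.
  have D0 := definable_rename (W := V) (fun x : V + 'I_0 => match x with inl v => v
    | inr i => False_rect _ (notF (ltn_ord i)) end) D.
  have E v (a : 'I_0 -> U) : v \o (fun x : V + 'I_0 => match x with inl v => v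
    | inr i => False_rect _ (notF (ltn_ord i)) end) = vcat v a.
    by apply/funext => -[//|[]].
  apply: eq_definable D0 => v; split.
    by rewrite (E _ (fun i => False_rect _ (notF (ltn_ord i)))); eexists; eassumption.
  by move=> [a]; rewrite -E.
pose r (x : V + 'I_n.+1) : option V + 'I_n := match x with inl v => inl (Some v)
  | inr i => if unlift ord0 i is Some j then inr j else inl None end.
have := definable_ex1 (IH _ _ (definable_rename r D)).
have E v b a0 (a : 'I_n -> U) (b0 : b ord0 = a0) (bS : forall i, b (lift ord0 i) = a i) :
  vcat (fun o : option V => if o is Some x then v x else a0) a \o r = vcat v b.
  apply/funext => -[//|i] /=; case: unliftP => [j ->|->] /=; by rewrite ?b0 ?bS.
apply: eq_definable => v; split.
  move=> [a0 [a H]]; exists (fun i => if unlift ord0 i is Some j then a j else a0).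
  rewrite -(E _ _ a0 a) ?unlift_none// => i; by rewrite liftK.
by move=> [b H]; exists (b ord0), (fun i => b (lift ord0 i)); rewrite (E _ b).
Qed.

(** Only finitely many coordinates of the quantified tuple matter, namely those listed by [c]. As
    [c] may list a coordinate twice, the finite tuple that is quantified instead has to be constant
    on the fibres of [c]; it then extends to [Z], with an arbitrary value [u0] elsewhere. *)
Lemma definable_ex A V Z (P : (V + Z -> U) -> Prop) : definable A P ->
  definable A (fun v => exists a, P (vcat v a)).
Proof.
move=> /definable_support [Y [c [Q [D E]]]].
pose c' := fun i : 'I_#|Y| => c (enum_val i).
pose Q' := fun w : V + 'I_#|Y| -> U => Q (w \o (fun x => match x with
  inl v => inl v | inr y => inr (enum_rank y) end)).
have D' : definable A (fun v => exists a, Q' (vcat v a) /\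
    forall ij : 'I_#|Y| * 'I_#|Y|, c' ij.1 = c' ij.2 -> a ij.1 = a ij.2).
  apply: (@definable_ex_ord A V _ (fun w => Q' w /\ forall ij : 'I_#|Y| * 'I_#|Y|,
    c' ij.1 = c' ij.2 -> w (inr ij.1) = w (inr ij.2))).
  apply: definable_and; first exact: definable_rename.
  apply: definable_forall => ij; apply: definable_imp; first exact: definable_const.
  by exists (Eq (Var (inl (inr ij.1))) (Var (inl (inr ij.2)))).
have EQ v a : Q' (vcat v a) <-> Q (vcat v (a \o enum_rank)).
  rewrite /Q'; apply: (eq_iff (Q)).
  by apply/funext; case.
apply: eq_definable D' => v; split.
  move=> [a [/EQ HQ ker]].
  have [u0] := carrier_inhabited U.
  exists (fun z => if pselect (exists i, c' i = z) is left h
                   then a (projT1 (cid h)) else u0).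
  rewrite E; apply: (iffLR (eq_iff Q _)) HQ.
  apply/esym/funext => -[//|y] /=; case: pselect => [h|[]]; last first.
      by exists (enum_rank y); rewrite /c' enum_rankK.
  case: (cid h) => i /= ci; apply: (ker (i, enum_rank y)) => /=.
    by rewrite ci /c' enum_rankK.
move=> [a /E H]; exists (a \o c'); split; last by case=> i j /= ->.
rewrite EQ; suff -> : (a \o c') \o enum_rank = a \o c by [].
by apply/funext => y /=; rewrite /c' enum_rankK.
Qed.

Lemma definable_unparam A V Z (d : Z -> U) (P : (V -> U) -> Prop) :
  definable (A `|` range d) P ->
  exists Q, definable A Q /\ forall v, P v <-> Q (vcat v d).
Proof.
move=> [phi H].
have S (a : {u | (A `|` range d) u}) :
  exists x : Z + {u | A u}, vcat d sval x = sval a.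
  case: a => u /= [Au|[z _ <-]]; first by exists (inr (exist _ u Au)).
  by exists (inl z).
have [s sE] := choice S.
pose phi' := formula_map (fun x : V + {u | (A `|` range d) u} => match x with
  inl v => inl (inl v) | inr a => match s a with inl z => inl (inr z)
   | inr u => inr u end end) phi.
exists (fun w => sat (vcat w sval) phi'); split; first by exists phi'.
move=> v; rewrite -H sat_map.
apply: (eq_iff (fun w => sat w phi)); by apply/funext => -[//|a] /=; rewrite -sE; case: (s a).
Qed.

Lemma definable_sat A V Y (phi : formula L (V + Y)) (b : Y -> U) :
  (forall y, A (b y)) -> definable A (fun v => sat (vcat v b) phi).
Proof.
move=> bA; apply: definable_fix bA (_ : definable A (fun w => sat w phi)).
by exists (formula_map inl phi) => w; rewrite sat_map.
Qed.

Lemma definable_inst A (X : finType) (P : (X -> U) -> Prop) : definable A P ->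
  exists (Y : finType) (phi : formula L (X + Y)) (b : Y -> U),
    (forall y, A (b y)) /\ forall a, sat (vcat a b) phi <-> P a.
Proof.
move=> [psi H]; have [Y [c [phi E]]] := formula_support psi.
exists Y, phi, (sval \o c); split=> [y|a]; first exact: svalP.
rewrite -H E sat_map; apply: (eq_iff (fun w => sat w phi)); by apply/funext; case.
Qed.

End Definable.

(** * Stable sequences *)

Section Eventually.
Implicit Types (P Q : nat -> Prop) (S : set nat).

Definition eventual P := exists k, forall i, k <= i -> P i.

Lemma eventual_all P : (forall i, P i) -> eventual P.
Proof. by move=> H; exists 0. Qed.

Lemma eventual_imp P Q : eventual P -> (forall i, P i -> Q i) -> eventual Q.
Proof. by move=> [k H] PQ; exists k => i /H/PQ. Qed.

Lemma eventual_and P Q :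
  eventual P -> eventual Q -> eventual (fun i => P i /\ Q i).
Proof.
move=> [k H] [l H']; exists (maxn k l) => i; rewrite geq_max => /andP[ki li].
by split; [apply: H|apply: H'].
Qed.

Lemma eventual_forall (I : finType) (P : I -> nat -> Prop) :
  (forall x, eventual (P x)) -> eventual (fun i => forall x, P x i).
Proof.
move=> /choice[k H]; exists (\max_x k x) => i ki x; apply: H.
by apply: leq_trans ki; apply: leq_bigmax.
Qed.

Lemma eventual_ge k : eventual (fun i => k <= i).
Proof. by exists k. Qed.

Lemma eventual_ex P : eventual P -> exists i, P i.
Proof. by move=> [k H]; exists k; apply: H. Qed.

Lemma not_eventual P : ~ eventual P -> forall k, exists2 i, k <= i & ~ P i.
Proof.
move=> nP k; apply: contrapT => n; apply: nP; exists k => i ki.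
by apply: contrapT => nPi; apply: n; exists i.
Qed.

Definition at_most n S :=
  forall s : seq nat, uniq s -> (forall i, i \in s -> S i) -> size s <= n.

Lemma at_most_cofinite n S : at_most n S -> eventual (fun i => ~ S i).
Proof.
move=> H; apply: contrapT => /not_eventual N.
suff [s [us ss]] : exists s : seq nat,
    [/\ uniq s, forall i, i \in s -> S i & size s = n.+1].
  by move=> ssz; have := H s us ss; rewrite ssz ltnn.
elim: n.+1 => [|m [s [us ss <-]]]; first by exists [::].
have [i ki /contrapT Si] := N (\max_(j <- s) j).+1.
exists (i :: s); split=> //=.
  rewrite us andbT; apply/negP => /(@leq_bigmax_seq _ s xpredT id).
  by move=> /(_ isT); rewrite leqNgt ki.
by move=> j; rewrite inE => /orP[/eqP->|/ss].
Qed.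

Lemma card_le_at_most n S : S #<= `I_n <-> at_most n S.
Proof.
split.
  move=> /pcard_leP[f] s us sS; rewrite -(size_map f) -[leqRHS](size_iota 0 n).
  apply: uniq_leq_size.
    rewrite map_inj_in_uniq// => i j /sS Si /sS Sj.
    by apply: inj; rewrite inE.
  move=> _ /mapP[i /sS Si ->]; rewrite mem_iota /= add0n.
  exact: (@funS _ _ S `I_n f).
(* [f i] is the number of members of [S] below [i]; on [S] it is injective with values below [n]. *)
move=> H; pose f i := count (fun j => `[<S j>]) (iota 0 i).
have fS i : f i.+1 = f i + `[<S i>] by rewrite /f -addn1 iotaD count_cat /= addn0.
have fmon i j : i <= j -> f i <= f j.
  by move=> /subnK<-; elim: (j - i) => // d IH; rewrite addSn fS (leq_trans IH) ?leq_addr.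
have fI i : S i -> f i < n.
  move=> Si; have <- : f i.+1 = (f i).+1 by rewrite fS asboolT// addn1.
  rewrite /f -size_filter; apply: H; first by rewrite filter_uniq ?iota_uniq.
  by move=> j; rewrite mem_filter => /andP[/asboolP].
have finj i j : S i -> i < j -> f i < f j.
  move=> Si ij; apply: leq_trans (fmon _ _ ij).
  by rewrite fS asboolT// addn1.
apply/pcard_leP; apply/injfunPex; exists f; first by move=> i /fI.
move=> i j; rewrite !inE => Si Sj fij.
by case: (ltngtP i j) => // [/(finj _ _ Si)|/(finj _ _ Sj)]; rewrite fij ltnn.
Qed.

Lemma card_ord_at_most n N S : at_most n S ->
  #|[set i : 'I_N | `[<S i>]]%SET| <= n.
Proof.
move=> H; rewrite cardE -(size_map val); apply: H.
  by rewrite map_inj_uniq ?enum_uniq//; apply: val_inj.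
by move=> _ /mapP[i + ->]; rewrite mem_enum inE => /asboolP.
Qed.

(** Among the first 2n+1 indices, the side with at most n members is always the minority, so the
    vote of these indices gives the eventual value. *)
Lemma at_most_majority n S : at_most n S \/ at_most n (~` S) ->
  eventual (fun i => ~ S i) <-> #|[set i : 'I_n.*2.+1 | `[<S i>]]%SET| <= n.
Proof.
have nn : ~ (eventual (fun i => ~ S i) /\ eventual S).
  by move=> [e e']; have [i []] := eventual_ex (eventual_and e e').
move=> [] H.
  by split=> _; [apply: card_ord_at_most|apply: at_most_cofinite H].
have e : eventual S.
  by apply: eventual_imp (at_most_cofinite H) _ => i /contrapT.
split=> [e'|]; first by case: nn.
move=> le; have := card_ord_at_most n.*2.+1 H.
have -> : [set i : 'I_n.*2.+1 | `[<(~` S) i>]]%SET =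
    (~: [set i : 'I_n.*2.+1 | `[<S i>]])%SET.
  by apply/setP => i; rewrite !inE asbool_neg.
move=> le'; have := leq_add le le'.
by rewrite cardsC card_ord addnn ltnn.
Qed.

(** For all large [j] the n+1 relations [R (k + s) j] hold together. Then [[set i | R i j]] has more
    than n members, so it is its complement that is bounded. *)
Lemma eventual_swap n (R : nat -> nat -> Prop) :
  (forall j, at_most n [set i | R i j] \/ at_most n (~` [set i | R i j])) ->
  eventual (fun i => eventual (fun j => R i j)) ->
  eventual (fun j => eventual (fun i => R i j)).
Proof.
move=> B [k H].
have /eventual_forall E : forall s : 'I_n.+1, eventual (fun j => R (k + s) j).
  by move=> s; apply: H; apply: leq_addr.
apply: eventual_imp E _ => j Rj; case: (B j) => [am|/at_most_cofinite].
  suff : n.+1 <= n by rewrite ltnn.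
  rewrite -{1}(size_iota k n.+1); apply: am; first exact: iota_uniq.
  move=> i; rewrite mem_iota addnS => /andP[ki ik] /=.
  have ikn : i - k < n.+1 by rewrite ltn_subLR// addnS.
  by have := Rj (Ordinal ikn); rewrite /= subnKC.
by move=> e; apply: eventual_imp e _ => i /contrapT.
Qed.

End Eventually.

(** * Uniform bounds along stable sequences and definability of their limits *)

Section StableSequences.
Variables (L : language) (U : structure L).
Implicit Types (A : set U) (X : finType).

(** Only finitely many of the variables in [V] and of the parameters of [P] occur, and all of these
    go into the tuple [b] of the definition of stability; hence one [n] serves for every [v]. *)
Lemma stable_at_most X (a : nat -> X -> U) A V (P : (X + V -> U) -> Prop) :
  stable_sequence a -> definable A P ->
  exists n, forall v, at_most n [set i | P (vcat (a i) v)] \/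
                      at_most n (~` [set i | P (vcat (a i) v)]).
Proof.
move=> st [phi H].
have [Y [c [psi E]]] := formula_support (formula_map (fun x : X + V + {u | A u} =>
   match x with inl (inl x) => inl x | inl (inr v) => inr (inl v)
   | inr u => inr (inr u) end) phi).
have [n Hn] := st Y psi; exists n => v.
have HP i : sat (vcat (a i) (vcat v sval \o c)) psi <-> P (vcat (a i) v).
  rewrite -H.
  transitivity (sat (vcat (a i) (vcat v sval)) (formula_map (vcat inl (inr \o c)) psi)).
    by rewrite sat_map; apply: (eq_iff (fun w => sat w psi)); apply/funext; case.
  rewrite -E sat_map; apply: (eq_iff (fun w => sat w phi)).
  by apply/funext => -[[]|].
have EP : [set i | sat (vcat (a i) (vcat v sval \o c)) psi] =
    [set i | P (vcat (a i) v)] by apply/seteqP; split=> i /HP.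
have EN : [set i | ~ sat (vcat (a i) (vcat v sval \o c)) psi] =
    ~` [set i | P (vcat (a i) v)] by rewrite -EP.
by case: (Hn (vcat v sval \o c)) => /card_le_at_most; rewrite ?EP ?EN; [left|right].
Qed.

Lemma at_most_stable X (a : nat -> X -> U) :
  (forall (Y : finType) (phi : formula L (X + Y)), exists n, forall b : Y -> U,
    at_most n [set i | sat (vcat (a i) b) phi] \/
    at_most n [set i | ~ sat (vcat (a i) b) phi]) -> stable_sequence a.
Proof.
move=> H Y phi; have [n Hn] := H Y phi; exists n => b.
by case: (Hn b) => /card_le_at_most; [left|right].
Qed.

Lemma eventual_dec X (a : nat -> X -> U) A V (P : (X + V -> U) -> Prop) :
  stable_sequence a -> definable A P -> forall v,
  eventual (fun i => P (vcat (a i) v)) \/ eventual (fun i => ~ P (vcat (a i) v)).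
Proof.
move=> st D v; have [n /(_ v)[]] := stable_at_most st D.
  by move=> /at_most_cofinite; right.
move=> /at_most_cofinite e; left.
by apply: eventual_imp e _ => i /contrapT.
Qed.

(** Limits of stable sequences are definable types: the uniform bound n lets the first 2n+1 terms,
    used as parameters, decide by majority. *)
Lemma definable_eventual X (a : nat -> X -> U) A V (P : (X + V -> U) -> Prop) :
  stable_sequence a -> (forall i x, A (a i x)) -> definable A P ->
  definable A (fun v => eventual (fun i => P (vcat (a i) v))).
Proof.
move=> st aA D; have [n Hn] := stable_at_most st (definable_not D).
pose S v := [set i : 'I_n.*2.+1 | `[<~ P (vcat (a i) v)>]]%SET.
have : definable A (fun v => #|S v| <= n).
  apply: (definable_bool (P := fun (i : 'I_n.*2.+1) v => ~ P (vcat (a i) v))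
     (fun s => #|s| <= n)) => i.
  apply: definable_not.
  pose g (x : X + V) : V + {u | A u} :=
    match x with inl x => inr (exist _ _ (aA i x)) | inr v => inl v end.
  apply: eq_definable (definable_subst g D) => v; apply: eq_iff.
  by apply/funext; case.
apply: eq_definable => v.
have := at_most_majority (Hn v); rewrite -/(S v) => <-.
by split=> e; apply: eventual_imp e _ => i; [apply: contrapT|move=> h /(_ h)].
Qed.

End StableSequences.

(** * Small sets and small models *)

(** Recursive choice where the condition on term [n] depends only on the earlier terms. The stage
    [sg n] has its first [n] terms chosen and is [a0] elsewhere; later stages keep them, so the
    diagonal [sg k.+1 k] is the limit. *)
Lemma dep_seq (A : Type) (a0 : A) (R : nat -> (nat -> A) -> A -> Prop) :
  (forall n s s' w, (forall l, l < n -> s l = s' l) -> R n s w -> R n s' w) ->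
  (forall n s, exists w, R n s w) -> exists s, forall n, R n s (s n).
Proof.
move=> Rpre Rex.
have [f fR] := choice (fun ns : nat * (nat -> A) => Rex ns.1 ns.2).
pose fix sg n : nat -> A := if n is m.+1 then
  fun k => if k == m then f (m, sg m) else sg m k else fun=> a0.
have sgE n k : k < n -> sg n k = sg k.+1 k.
  elim: n => // n IH; rewrite ltnS leq_eqVlt => /orP[/eqP->//|kn].
  by rewrite [LHS]/= ltn_eqF// IH.
exists (fun k => sg k.+1 k) => n.
apply: Rpre (_ : R n (sg n) _) => [l ln|]; first exact: sgE.
by rewrite /= eqxx; apply: (fR (n, sg n)).
Qed.

Section Smallness.
Variables (L : language) (U : structure L) (K : Type).
Hypothesis hK : card_lt K [set: formula L nat].
Implicit Types (A C : set U).

Lemma card_le_exP T (V : Type) (v0 : V) (A : set T) (B : set V) :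
  A #<= B <-> exists2 f : T -> V, set_fun A B f & set_inj A f.
Proof.
elim/Ppointed: V => V in v0 B *; first by case: (no v0).
rewrite -injfunPex; split=> [/pcard_leP//|H]; exact/pcard_leP.
Qed.

Lemma not_countable_K : ~ countable [set: K].
Proof.
move=> /card_le_trans cK; apply: hK; apply: cK.
apply/card_le_exP; first exact: Bot.
exists (fun n => Eq (Var n) (Var n)) => // n m _ _.
by move=> [].
Qed.

Lemma card_lt_countable C : countable C -> card_lt K C.
Proof. by move=> cC /sub_countable /(_ cC); apply: not_countable_K. Qed.

(** If [A] is infinite, it contains a sequence [s]. As in Hilbert's hotel, [h] moves [s n] to the
    even index 2n and sends the new elements of [C] to odd indices, so the union injects into
    [A]. *)
Lemma card_lt_setU A C : card_lt K A -> countable C -> card_lt K (A `|` C).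
Proof.
move=> KA cC KAC; have [u0] := carrier_inhabited U.
case: (EM (finite_set A)) => [/finite_set_countable cA|/infiniteP].
  apply: not_countable_K; apply: sub_countable KAC _.
  rewrite -bigcup2E; apply: bigcup_countable; first exact: countableP.
  by case=> [|[|i]] _ //=; apply: countable0.
move=> /(card_le_exP u0)[s sA sinj]; apply: KA.
move: cC => /countable_injP[g ginj].
move: KAC => /(card_le_exP u0)[f fAC finj].
have s_eq n m : s n = s m -> n = m by move=> E; apply: sinj; rewrite ?inE.
pose h u := if pselect (exists n, s n = u) is left H then s (projT1 (cid H)).*2
  else if pselect (A u) then u else s (g u).*2.+1.
apply/(card_le_exP u0); exists (h \o f).
  move=> k _ /=; rewrite /h; case: pselect => [H|nH]; first exact: sA.
  by case: pselect => // nA; apply: sA.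
have hinj u v : (A `|` C) u -> (A `|` C) v -> h u = h v -> u = v.
  move=> ACu ACv; rewrite /h.
  case: (pselect (exists n, s n = u)) => [H|nH];
    case: (pselect (exists n, s n = v)) => [H'|nH'].
  - case: (cid H) (cid H') => n /= <- [m /= <-].
    by move=> /s_eq /double_inj ->.
  - case: (pselect (A v)) => [Av|nAv] /=.
      by move=> E; case: nH'; eexists; exact: E.
    by move=> /s_eq /(congr1 odd); rewrite /= !odd_double.
  - case: (pselect (A u)) => [Av|nAv] /=.
      by move=> E; case: nH; eexists; exact/esym/E.
    by move=> /s_eq /(congr1 odd); rewrite /= !odd_double.
  - case: (pselect (A u)) => Au; case: (pselect (A v)) => Av //=.
    + by move=> E; case: nH; eexists; exact/esym/E.
    + by move=> E; case: nH'; eexists; exact: E.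
    + move=> /s_eq -[/double_inj]; apply: ginj; rewrite inE.
        by case: ACu.
      by case: ACv.
by move=> k l _ _ /= /hinj E; apply: finj; rewrite ?inE//; apply: E; apply: fAC.
Qed.

(* The formula [Imp phi psi] codes a Skolem witness for [phi] at the list of
    parameters coded by [psi]; the list coded by [Imp phi psi] is the element
    coded by [phi] followed by the list coded by [psi]. *)
Section LowenheimSkolem.
Variables (u0 : U) (s : nat -> U).

Definition list_env (l : seq U) (u : U) (n : nat) : U :=
  if n is k.+1 then nth u0 l k else u.

Definition witness (phi : formula L nat) (l : seq U) : U :=
  if pselect (exists u, sat (list_env l u) phi) is left h then projT1 (cid h)
  else u0.

Fixpoint decode V (phi : formula L V) (i : V -> nat) : U * seq U :=
  match phi with
  | Imp phi psi => (witness (formula_map i phi) (decode psi i).2,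
                    (decode phi i).1 :: (decode psi i).2)
  | Eq (Var n) _ => (s (i n), [::])
  | _ => (u0, [::])
  end.

(** Indexing the hull by formulas bounds its cardinality by the number of formulas, which makes it
    small. *)
Definition skolem_hull : set U := range (fun phi => (decode phi id).1).

Lemma skolem_hull_mem n : skolem_hull (s n).
Proof. by exists (Eq (Var n) (Var n)). Qed.

Lemma skolem_hull_u0 : skolem_hull u0.
Proof. by exists Bot. Qed.

Lemma decode_list (l : seq U) : (forall k, k < size l -> skolem_hull (nth u0 l k)) ->
  exists phi, (decode phi id).2 = l.
Proof.
elim: l => [|u l IH] H; first by exists Bot.
have [phi _ E] := H 0 isT.
have [psi E'] := IH (fun k => H k.+1).
by exists (Imp phi psi); rewrite /= E E'.
Qed.

Lemma skolem_hull_witness phi l :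
  (forall k, k < size l -> skolem_hull (nth u0 l k)) ->
  (exists u, sat (list_env l u) phi) ->
  exists2 u, skolem_hull u & sat (list_env l u) phi.
Proof.
move=> /decode_list[psi <-] ex.
exists (decode (Imp phi psi) id).1; first by exists (Imp phi psi).
rewrite /= /witness formula_map_id; case: pselect => // h; by case: cid.
Qed.

Lemma skolem_hull_witness_fin (Y : finType) (c : Y -> U)
    (phi : formula L (unit + Y)) :
  (forall y, skolem_hull (c y)) ->
  (exists u, sat (vcat (fun=> u) c) phi) ->
  exists2 u, skolem_hull u & sat (vcat (fun=> u) c) phi.
Proof.
move=> hc; pose l := [seq c y | y <- enum Y].
pose g (x : unit + Y) := if x is inr y then (enum_rank y).+1 else 0.
have E u : sat (vcat (fun=> u) c) phi = sat (list_env l u) (formula_map g phi).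
  rewrite sat_map; congr sat; apply/funext => -[//|y] /=.
  by rewrite (nth_map y) ?nth_enum_rank// -cardE.
move=> [u]; rewrite E => H.
have [k kl|v hv] := skolem_hull_witness _ (ex_intro _ u H).
  have [y0 _] : exists y0 : Y, true.
    by move: kl; rewrite size_map; case: (enum Y) => // y; exists y.
  rewrite (nth_map y0) //; by rewrite size_map in kl.
by rewrite -E; exists v.
Qed.

(** The Tarski-Vaught test. Closure under a function symbol comes from a witness for the equation
    giving its value, and a universal formula that fails has a counterexample in the hull. *)
Lemma skolem_hull_elementary : elementary_substructure skolem_hull.
Proof.
have M0 : inhabited skolem_hull.
  by apply: inhabits (SigSub (mem_set skolem_hull_u0)).
have val_mem (x : skolem_hull) : skolem_hull (set_val x) by apply: set_mem (valP x).
have clM (f : Defs.fsym L) (a : 'I_(farity f) -> skolem_hull) :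
    skolem_hull (fint (fun i => set_val (a i))).
  have [||u hu /= <-] // := @skolem_hull_witness_fin _ (fun i => set_val (a i))
    (Eq (Var (inl tt)) (App f (fun i => Var (inr i)))).
  by exists (fint (fun i => set_val (a i))).
exists M0, clM => X phi a.
have ev_val V (t : term L V) (b : V -> skolem_hull) :
    set_val (@eval L (induced M0 clM) V b t) = eval (set_val \o b) t.
  by elim: t => //= f ts IH; congr fint; apply/funext => i.
elim: {X} (X : Type) / phi a => [V a|V t1 t2 a|V r ts a|V p IHp q IHq a|V p IH a] /=.
- by [].
- rewrite -!ev_val; split=> [->//|]; exact: val_inj.
- by under eq_fun do rewrite ev_val.
- by rewrite IHp IHq.
- have envE (m : skolem_hull) : (fun o : option V => if o is Some x then (set_val \o a) x else set_val m)
     = set_val \o (fun o => if o is Some x then a x else m).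
    by apply/funext; case.
  split=> H; last by move=> m; apply/IH; rewrite -envE; apply: H.
  apply: contrapT => nall.
  have [Y [c [phi0 E]]] := formula_support_map
    (fun o : option V => if o is Some v then inr v else inl tt) p.
  have EE u : sat (fun o : option V => if o is Some x then (set_val \o a) x else u) p
     = sat (vcat (fun=> u) (set_val \o a \o c)) phi0.
    have := sat_map (fun o : option V => if o is Some v then inr v else inl tt)
       (vcat (fun=> u) (set_val \o a)) p.
    rewrite E sat_map => EE; transitivity (sat (vcat (fun=> u) (set_val \o a) \o
      (fun o : option V => if o is Some v then inr v else inl tt)) p).
      by congr sat; apply/funext; case.
    by rewrite -EE; congr sat; apply/funext; case=> [[]|].
  have [||u hu] := @skolem_hull_witness_fin _ (set_val \o a \o c) (Neg phi0).
  + by move=> y; apply: val_mem.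
  + apply: contrapT => nex; apply: nall => u; rewrite EE.
    by apply: contrapT => nu; apply: nex; exists u.
  + move=> /= nu; apply: nu; rewrite -EE.
    have := H (SigSub (mem_set hu)); rewrite IH -envE.
    by [].
Qed.

End LowenheimSkolem.

Lemma small_model_through (C : countType) (s : C -> U) :
  exists2 M : set U, small_model K M & forall c, M (s c).
Proof.
have [u0] := carrier_inhabited U.
pose s' n := if unpickle n is Some c then s c else u0.
exists (skolem_hull u0 s'); last first.
  by move=> c; have := skolem_hull_mem u0 s' (pickle c); rewrite /s' pickleK.
split; last exact: skolem_hull_elementary.
by move=> /card_le_trans h; apply: hK; apply: h; apply: card_image_le.
Qed.

End Smallness.

(** * Saturation and Morley sequences *)

Section Saturation.
Variables (L : language) (U : structure L) (K : Type).
Hypothesis hS : saturated K U.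
Implicit Types (A : set U).

Lemma saturated_definable A (X : finType) I (P : I -> (X -> U) -> Prop) :
  card_lt K A -> (forall i, definable A (P i)) ->
  (forall k (G : 'I_k -> I), exists a, forall j, P (G j) a) ->
  exists a, forall i, P i a.
Proof.
move=> KA D fs.
pose S : set (formula L (X + U)) := [set psi | params_in A psi /\
  exists i, forall a, sat (vcat a id) psi <-> P i a].
have [|k F FS|a aS] := @hS A X S KA; first by move=> psi [].
  have /choice[G GE] := fun j => (FS j).2.
  have [a Pa] := fs _ G.
  by exists a => j; apply/GE.
exists a => i; have [Y [phi [b [bA E]]]] := definable_inst (D i).
have iE c : sat (vcat c id) (inst phi b) <-> P i c by rewrite sat_inst.
by apply/iE; apply: aS; split; [exists Y, phi, b|exists i].
Qed.

End Saturation.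

(** * Sequences of tuples as assignments of variables *)

Section Sequences.
Variables (L : language) (U : structure L).
Implicit Types (A : set U) (W : finType).

(** A sequence of [W]-tuples becomes a single assignment, so that [definable] applies to conditions
    on whole sequences. *)
Definition flat W (s : nat -> W -> U) (x : nat * W) : U := s x.1 x.2.

Definition upd W (s : nat -> W -> U) n (w : W -> U) k := if k == n then w else s k.

Definition earlier W (s : nat -> W -> U) n : set U :=
  [set u | exists2 j, j < n & exists x, u = s j x].

Lemma upd_id W (s : nat -> W -> U) n : upd s n (s n) = s.
Proof. by apply/funext => k; rewrite /upd; case: eqP => [->|]. Qed.

Lemma definable_finite_support A W (P : (nat * W -> U) -> Prop) : definable A P ->
  exists n, forall s s', (forall k, k < n -> s k = s' k) ->
    P (flat s) <-> P (flat s').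
Proof.
move=> D.
have D' : definable A (fun v : void + nat * W -> U => P (v \o inr)).
  exact: definable_rename.
have [Y [c [Q [_ E]]]] := definable_support D'.
exists (\max_(y : Y) (c y).1).+1 => s s' ss'.
have PE v : P v <-> Q (vcat (of_void U) (v \o c)) by rewrite -E.
rewrite !PE; apply: eq_iff; apply/funext => -[//|y] /=; rewrite /flat ss'//.
by rewrite ltnS; apply: (leq_bigmax y).
Qed.

Lemma definable_flat A W V (h : nat -> W -> V + {u | A u})
    (P : (nat * W -> U) -> Prop) :
  definable A P -> definable A (fun v => P (flat (fun k x => vcat v sval (h k x)))).
Proof. exact: (@definable_subst _ _ _ _ _ (fun x => h x.1 x.2)). Qed.

Lemma definable_flat_fix A W V (h : nat -> W -> option V) (s : nat -> W -> U)
    (P : (nat * W -> U) -> Prop) :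
  (forall k x, h k x = None -> A (s k x)) -> definable A P ->
  definable A (fun v => P (flat (fun k x => if h k x is Some y then v y else s k x))).
Proof.
move=> hs D.
have cx k x : {z : V + {u | A u} |
    forall v, vcat v sval z = if h k x is Some y then v y else s k x}.
  case E : (h k x) => [y|]; first by exists (inl y).
  by exists (inr (exist _ _ (hs k x E))).
apply: eq_definable (definable_flat (fun k x => projT1 (cid (ex_intro _ _ (svalP (cx k x))))) D) => v.
apply: eq_iff; congr flat; apply/funext => k; apply/funext => x.
by case: cid.
Qed.

(* Coordinate [n] is the variable; those from [m] on are irrelevant. *)
Lemma definable_upd A W (s : nat -> W -> U) n m (P : (nat * W -> U) -> Prop) :
  (forall s s', (forall k, k < m -> s k = s' k) -> P (flat s) <-> P (flat s')) ->
  (forall k x, k < m -> k != n -> A (s k x)) -> definable A P ->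
  definable A (fun w => P (flat (upd s n w))).
Proof.
move=> Pm sA D.
case: (posnP #|W|) => [W0|/card_gt0P[x0 _]].
  apply: eq_definable (definable_const A W (P (flat s))) => w.
  by apply: eq_iff; apply/funext => -[i x]; have := card0_eq W0 x; rewrite !inE.
(* The irrelevant coordinates from [m] on are also filled with the variable, so that they bring in
   no parameter. *)
pose h k (x : W) := if (k == n) || (m <= k) then Some x else None.
apply: eq_definable (definable_flat_fix (h := h) (s := s) _ D) => [w|k x]; last first.
  by rewrite /h; case: ifP => // /norP[kn mk] _; apply: sA; rewrite // ltnNge.
apply: Pm => k km; apply/funext => x; rewrite /h /upd leqNgt km orbF.
by case: ifP.
Qed.

End Sequences.

(** * Saturation for countable sequences of variables *)

Section OmegaSaturation.
Variables (L : language) (U : structure L) (K : Type).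
Hypothesis hK : card_lt K [set: formula L nat].
Hypothesis hS : saturated K U.

Lemma countable_range (C : countType) (f : C -> U) : countable (range f).
Proof. by apply: sub_countable (card_image_le _ _) _; apply: countableP. Qed.

(** Saturation speaks of finite tuples, so the sequence is realized term by term. The invariant
    [good n s] says that the conditions remain finitely satisfiable by sequences starting with the
    first [n] terms of [s]; these are only countably many new parameters. In the end each condition
    depends on finitely many terms. *)
Lemma saturated_sequence A (W : finType) I (P : I -> (nat * W -> U) -> Prop) :
  card_lt K A -> (forall i, definable A (P i)) ->
  (forall (J : finType) (G : J -> I), exists s, forall j, P (G j) (flat s)) ->
  exists s, forall i, P i (flat s).
Proof.
move=> KA D fs.
pose good n s := forall k (G : 'I_k -> I), exists s',
  (forall l, l < n -> s l = s' l) /\ forall j, P (G j) (flat s').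
have [u0] := carrier_inhabited U.
have [||s sP] := dep_seq (fun _ => u0)
    (R := fun n s w => good n s -> good n.+1 (upd s n w)).
- move=> n s s' w ss' gs gs' k G.
  have g : good n s.
    move=> k' G'; have [t [tE tP]] := gs' k' G'; exists t; split=> // l ln.
    by rewrite ss'// tE.
  have [t [tE tP]] := gs g k G; exists t; split=> // l ln.
  rewrite -tE// /upd; case: eqP => // nl; rewrite ss'//.
  by move: ln; rewrite ltnS leq_eqVlt => /orP[/eqP|].
- move=> n s; case: (EM (good n s)) => [g|ng]; last by exists (fun=> u0).
  pose A' := A `|` range (flat s).
  have KA' : card_lt K A' by apply: card_lt_setU => //; apply: countable_range.
  (* For each finite list of conditions, [w] must be a possible next term. Finitely many such
     demands amount to one, for the concatenation of the lists. *)
  pose Q (kG : {k & 'I_k -> I}) (w : W -> U) := exists s', forall j,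
    P (tagged kG j) (flat (fun k => if k < n then s k else if k == n then w
                           else fun x => s' (k, x))).
  have [||w wQ] := saturated_definable hS (P := Q) KA'.
  + move=> [k G]; pose h l (x : W) : option (W + nat * W) := if l < n then None
      else if l == n then Some (inl x) else Some (inr (l, x)).
    have : definable A' (fun v => exists s' : nat * W -> U, forall j, P (G j) (flat
        (fun l x => if h l x is Some y then vcat v s' y else s l x))).
      apply: (definable_ex (P := fun v => forall j, P (G j) (flat
        (fun l x => if h l x is Some y then v y else s l x)))).
      apply: definable_forall => j; apply: definable_flat_fix.
        by move=> l x _; right; exists (l, x).
      by apply: definable_subset (D _) => u; left.
    apply: eq_definable => w; split=> -[s' H]; exists s' => j;
      apply: (iffLR (eq_iff _ _)) (H j); congr flat; apply/funext => l;
      apply/funext => x; rewrite /h; by case: ltnP => // _; case: eqP.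
  + move=> m G.
    have [s' [ss' s'P]] := g _ (fun i : 'I_#|{: {j : 'I_m & 'I_(tag (G j))}}| =>
      let x := enum_val i in tagged (G (tag x)) (tagged x)).
    exists (s' n) => j; exists (fun x => s' x.1 x.2) => i.
    have := s'P (enum_rank (Tagged (fun j => 'I_(tag (G j))) i)).
    rewrite enum_rankK /=; apply: (iffLR (eq_iff _ _)); congr flat.
    apply/funext => l; case: ltnP => [/ss'//|_]; by case: eqP => [->|].
  exists w => _ k G; have [s' s'P] := wQ (existT _ k G).
  exists (fun k => if k < n then s k else if k == n then w
                           else fun x => s' (k, x)); split=> // l.
  by rewrite /upd ltnS leq_eqVlt; case: eqP => [->|_ /= ->//]; rewrite ltnn.
have gs n : good n s.
  elim: n => [|n /sP]; last by rewrite upd_id.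
  move=> k G; have [s' s'P] := fs _ G; by exists s'.
exists s => i; have [n Hn] := definable_finite_support (D i).
have [s' [ss' s'P]] := gs n 1 (fun=> i).
by apply/(Hn _ _ ss'); apply: (s'P ord0).
Qed.

End OmegaSaturation.

(** * Global types as families of definable sets *)

Section GlobalTypes.
Variables (L : language) (U : structure L) (X : finType).
Implicit Types (A : set U) (p : set (formula L (X + U))) (P Q : (X -> U) -> Prop).

(* The definable set [P] belongs to [p]. *)
Definition holds p P := exists2 psi, p psi & forall a, sat (vcat a id) psi <-> P a.

Lemma definableT A V (P : (V -> U) -> Prop) : definable A P -> definable setT P.
Proof. exact: definable_subset. Qed.

Lemma holds_sat p k (P : 'I_k -> (X -> U) -> Prop) : global_type p ->
  (forall i, holds p (P i)) -> exists a, forall i, P i a.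
Proof.
move=> [fs _] H.
have [F FE] : exists F : 'I_k -> formula L (X + U),
    forall i, p (F i) /\ forall a, sat (vcat a id) (F i) <-> P i a.
  have [F FE] := choice (fun i => let: ex_intro2 psi pp E := H i in
    ex_intro (fun psi => p psi /\ forall a, sat (vcat a id) psi <-> P i a) psi (conj pp E)).
  by exists F.
have [a aF] := fs k F (fun i => (FE i).1).
exists a => i; exact/(FE i).2.
Qed.

(** A complete and finitely satisfiable type is closed under equivalence: otherwise it would contain
    [Neg phi] together with a formula equivalent to [phi]. *)
Lemma holdsP p phi : global_type p ->
  p phi <-> holds p (fun a => sat (vcat a id) phi).
Proof.
move=> gp; split=> [pphi|[psi ppsi E]]; first by exists phi.
case: (proj2 gp phi) => // nphi; exfalso.
have [|a H] := holds_sat (k := 2) (P := fun i a => if i == ord0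
    then sat (vcat a id) phi else ~ sat (vcat a id) phi) gp.
  by move=> i; case: (i == ord0); [exists psi|exists (Neg phi)].
exact: (H ord_max (H ord0)).
Qed.

Lemma holds_inst p P (Y : finType) (phi : formula L (X + Y)) (b : Y -> U) :
  global_type p -> (forall a, sat (vcat a b) phi <-> P a) ->
  p (inst phi b) <-> holds p P.
Proof.
move=> gp E; rewrite holdsP//.
have E' a : sat (vcat a id) (inst phi b) <-> P a by rewrite sat_inst.
by split=> -[psi ppsi H]; exists psi => // a; rewrite H E'.
Qed.

Lemma holds_dec p P : global_type p -> definable setT P ->
  holds p P \/ holds p (fun a => ~ P a).
Proof.
move=> gp /definable_inst[Y [phi [b [_ E]]]].
have E' a : sat (vcat a id) (inst phi b) <-> P a by rewrite sat_inst.
case: (proj2 gp (inst phi b)) => h; [left|right].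
  by exists (inst phi b).
by exists (Neg (inst phi b)) => // a /=; rewrite E'.
Qed.

Lemma realizesP A p a : global_type p ->
  realizes A p a <-> forall P, definable A P -> holds p P -> P a.
Proof.
move=> gp; split=> [H P /definable_inst[Y [phi [b [bA E]]]] hP|H phi pphi].
  apply/E; rewrite -sat_inst; apply: H; last by exists Y, phi, b.
  exact/(holds_inst gp E).
move=> [Y [phi0 [b [bA E]]]]; move: pphi; rewrite E => /(holdsP _ gp) h.
apply: H h; apply: eq_definable (definable_sat (b := b) phi0 bA) => c.
by rewrite sat_inst.
Qed.

End GlobalTypes.

Section Morley.
Variables (L : language) (U : structure L) (K : Type).
Hypothesis hS : saturated K U.
Variables (X : finType) (A : set U) (p : set (formula L (X + U))).
Hypothesis gp : global_type p.

Lemma countable_earlier (s : nat -> X -> U) n : countable (earlier s n).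
Proof.
apply: sub_countable (countable_range (flat s)); apply: subset_card_le.
by move=> u [j _ [x ->]]; exists (j, x).
Qed.

Lemma exists_realizes : card_lt K A -> exists a, realizes A p a.
Proof.
move=> KA.
have [||a H] := saturated_definable hS (I := {P | definable A P /\ holds p P})
   (P := fun P => sval P) KA.
- by move=> [P []].
- move=> k G; apply: (holds_sat gp) => i; by case: (G i) => P [].
by exists a; apply/(realizesP _ _ gp) => P D hP; apply: (H (exist _ P (conj D hP))).
Qed.

End Morley.

Lemma exists_Morley (L : language) (U : structure L) (K : Type)
    (hK : card_lt K [set: formula L nat]) (hS : saturated K U) (X : finType)
    (A : set U) (p : set (formula L (X + U))) :
  global_type p -> card_lt K A -> exists a, Morley_sequence A p a.
Proof.
move=> gp KA; have [u0] := carrier_inhabited U.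
apply: (dep_seq (fun=> u0) (R := fun n s => realizes (A `|` earlier s n) p)).
  move=> n s s' w ss'; suff -> : earlier s n = earlier s' n by [].
  by apply/seteqP; split=> u [j jn [x ->]]; exists j => //; exists x; rewrite ss'.
move=> n s; apply: (exists_realizes hS gp); apply: card_lt_setU => //.
exact: countable_earlier.
Qed.

(** * Limits of stable sequences *)

Section LimitTypes.
Variables (L : language) (U : structure L).
Implicit Types (A M : set U) (X W : finType).

Definition limit_type X (a : nat -> X -> U) : set (formula L (X + U)) :=
  [set phi | eventual (fun i => sat (vcat (a i) id) phi)].

Lemma definable_formula A V (phi : formula L V) :
  definable A (fun v : V -> U => sat v phi).
Proof. by exists (formula_map inl phi) => v; rewrite sat_map. Qed.

Lemma global_limit_type X (a : nat -> X -> U) :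
  stable_sequence a -> global_type (limit_type a).
Proof.
move=> st; split=> [k F FS|phi].
  by have [i] := eventual_ex (eventual_forall FS); exists (a i).
exact: (eventual_dec st (definable_formula set0 phi) id).
Qed.

Lemma holds_limit_type X (a : nat -> X -> U) (P : (X -> U) -> Prop) :
  definable setT P -> holds (limit_type a) P <-> eventual (fun i => P (a i)).
Proof.
move=> D; split=> [[psi e E]|e]; first by apply: eventual_imp e _ => i /E.
have [Y [phi [b [_ E]]]] := definable_inst D.
have E' c : sat (vcat c id) (inst phi b) <-> P c by rewrite sat_inst.
by exists (inst phi b) => //; apply: eventual_imp e _ => i /E'.
Qed.

Lemma lim_type_eq X (a : nat -> X -> U) (p : set (formula L (X + U))) :
  global_type p -> lim_type a p -> p = limit_type a.
Proof.
move=> gp la; apply/seteqP; split=> phi; first exact: la.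
move=> e; case: (proj2 gp phi) => // /la e'.
have [i [h h']] := eventual_ex (eventual_and e e'); case: (h' h).
Qed.

Lemma realizes_subset X A B (p : set (formula L (X + U))) a :
  A `<=` B -> realizes B p a -> realizes A p a.
Proof.
move=> AB H phi pphi [Y [psi [b [bA E]]]]; apply: H => //.
by exists Y, psi, b; split=> // y; apply: AB; apply: bA.
Qed.

Lemma Morley_subset X A B (p : set (formula L (X + U))) a :
  A `<=` B -> Morley_sequence B p a -> Morley_sequence A p a.
Proof. by move=> AB H i; apply: realizes_subset (H i); apply: setSU. Qed.

Lemma Morley_subseq X A (p : set (formula L (X + U))) a (u : nat -> nat) :
  {homo u : i j / i < j} ->
  Morley_sequence A p a -> Morley_sequence A p (a \o u).
Proof.
move=> um H i; apply: realizes_subset (H (u i)); apply: setUS.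
by move=> v [j ji [x ->]]; exists (u j); [apply: um|exists x].
Qed.

Lemma MorleyP X A (p : set (formula L (X + U))) a : global_type p ->
  Morley_sequence A p a <-> forall i P, definable (A `|` earlier a i) P ->
    holds p P -> P (a i).
Proof.
by move=> gp; split=> H i; [move=> P D h|apply/(realizesP _ _ gp)=> P D h];
  [apply: (iffLR (realizesP _ _ gp) (H i))|apply: H].
Qed.

Lemma Morley_holds X A (p : set (formula L (X + U))) a i P : global_type p ->
  Morley_sequence A p a -> definable (A `|` earlier a i) P -> P (a i) -> holds p P.
Proof.
move=> gp /(MorleyP _ _ gp) H D Pa; case: (holds_dec gp (definableT D)) => // h.
by case: (H i _ (definable_not D) h).
Qed.

(* The terms of the Morley sequence are replaced by members of the family [g],
   which approximates its type, starting from the last one. *)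
Lemma Morley_approx W A (p : set (formula L (W + U))) (c : nat -> W -> U)
    I (g : I -> W -> U) (fresh : I -> I -> Prop) (i0 : I) n
    (R : (nat * W -> U) -> Prop) :
  global_type p -> Morley_sequence A p c -> (forall i x, A (g i x)) ->
  (forall P, definable setT P -> holds p P -> forall m (u : nat -> I),
     exists i, P (g i) /\ forall l, l < m -> fresh i (u l)) ->
  definable A R ->
  (forall s s', (forall k, k < n -> s k = s' k) -> R (flat s) <-> R (flat s')) ->
  R (flat c) -> exists u : nat -> I,
    (forall k l, k < l < n -> fresh (u k) (u l)) /\ R (flat (fun k => g (u k))).
Proof.
move=> gp Mc gA H D supp Rc.
(* The induction is on the number of replaced terms: those before the cut are still terms of [c],
   the others already come from [g]. The cut moves from [n] down to 0. *)
suff [u [fu Ru]] : exists u : nat -> I,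
    (forall k l, n - n <= k -> k < l < n -> fresh (u k) (u l)) /\
    R (flat (fun k => if k < n - n then c k else g (u k))).
  exists u; split=> [k l|]; first by apply: fu; rewrite subnn.
  by move: Ru; rewrite subnn.
have : n <= n by [].
elim: {1 4 7}n => [_|m IH mn].
  exists (fun=> i0); split; first by move=> k l; rewrite subn0 => ? ?; exfalso; lia.
  apply: (iffLR (supp _ _ _)) Rc => k kn; by rewrite subn0 kn.
have [u [fu Ru]] := IH (ltnW mn).
set k0 := n - m.+1; have k0E : n - m = k0.+1 by rewrite /k0; lia.
have k0n : k0 < n by rewrite /k0; lia.
rewrite {}k0E in fu Ru; set s := (fun _ => _) in Ru.
have DP : definable (A `|` earlier c k0) (fun w => R (flat (upd s k0 w))).
  apply: (definable_upd supp); last by apply: definable_subset D; left.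
  move=> k x kn kk0; rewrite /s ltnS leq_eqVlt (negPf kk0) /=.
  by case: ltnP => kk; [right; exists k => //; exists x|left].
have Pc : R (flat (upd s k0 (c k0))).
  by have -> : c k0 = s k0; [rewrite /s ltnSn|rewrite upd_id].
(* The replaced terms lie in [A], so the condition on [c k0] is over [A] and the earlier terms, and
   it belongs to [p] because [c k0] satisfies it. Some member of the family therefore satisfies it
   too. *)
have h := Morley_holds gp Mc DP Pc.
have [i [Pi fi]] := H _ (definableT DP) h n u.
exists (fun k => if k == k0 then i else u k); split.
  move=> k l k0k /andP[kl ln]; have -> : (l == k0) = false by lia.
  by case: eqP => [_|nk]; [apply: fi|apply: fu; lia].
apply: (iffLR (eq_iff R _)) Pi; congr flat; apply/funext => k.
rewrite /upd /s; case: eqP => [->|nk]; first by rewrite ltnn.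
by have -> : (k < k0.+1) = (k < k0) by lia.
Qed.

(** * Morley sequences of the limit of a stable sequence *)

Section StableMorley.
Variables (X : finType) (A : set U) (a c : nat -> X -> U).
Hypotheses (st : stable_sequence a) (aA : forall i x, A (a i x)).
Hypothesis Mc : Morley_sequence A (limit_type a) c.

(** Suppose [P] fails at more than [n] terms of [c] for some [v] at which it is generic. The
    existence of such a [v] is a condition over [A], as limits are definable, so by approximation it
    holds with distinct terms of [a] in place of those of [c]. This contradicts the bound [n] for
    [a]. *)
Lemma stable_Morley_at_most V (P : (X + V -> U) -> Prop) n : definable A P ->
  (forall v, at_most n [set i | P (vcat (a i) v)] \/
             at_most n (~` [set i | P (vcat (a i) v)])) ->
  forall v, eventual (fun i => P (vcat (a i) v)) ->
    at_most n [set i | ~ P (vcat (c i) v)].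
Proof.
move=> D Hn v ev s us sP; rewrite leqNgt; apply/negP => ns.
pose R (w : nat * X -> U) := exists v : V -> U,
  eventual (fun i => P (vcat (a i) v)) /\
  forall i : seq_sub s, ~ P (vcat (fun x => w (val i, x)) v).
pose N := (\max_(j <- s) j).+1.
have sN i : i \in s -> i < N.
  by move=> si; rewrite ltnS; apply: (@leq_bigmax_seq _ s xpredT id).
have DR : definable A R.
  apply: (definable_ex (P := fun wv => eventual (fun i => P (vcat (a i) (wv \o inr))) /\
    forall i : seq_sub s, ~ P (vcat (fun x => wv (inl (val i, x))) (wv \o inr)))).
  apply: definable_and.
    exact: definable_rename (definable_eventual st aA D).
  apply: definable_forall => i; apply: definable_not.
  apply: eq_definable (definable_rename (fun x => match x with inl x => inl (val i, x)
     | inr v => inr v end) D) => w; apply: eq_iff.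
  by apply/funext; case.
have Rs w w' : (forall k, k < N -> w k = w' k) -> R (flat w) <-> R (flat w').
  have RR w1 w2 : (forall k, k < N -> w1 k = w2 k) -> R (flat w1) -> R (flat w2).
    move=> ww [v0 [ev0 H]]; exists v0; split=> // i.
    apply: (iffLR (eq_iff (fun z => ~ P (vcat z v0)) _)) (H i).
    by apply/funext => x; rewrite /flat /= ww// sN// ssvalP.
  by move=> ww; split; apply: RR => // k kN; rewrite ww.
have Rc : R (flat c) by exists v; split=> // i; apply: sP; apply: ssvalP.
have [Q DQ|u [fu [v0 [ev0 Hu]]]] := Morley_approx (fresh := fun i j => i <> j) 0
    (global_limit_type st) Mc aA _ DR Rs Rc.
  move=> /(holds_limit_type _ DQ) e m u.
  have [i [Qi im]] := eventual_ex (eventual_and e (eventual_ge (\max_(l < m) u l).+1)).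
  exists i; split=> // l lm iE; move: im; rewrite iE ltnNge.
  by rewrite (leq_bigmax (Ordinal lm)).
case: (Hn v0) => [/at_most_cofinite e|am].
  have [i [h h']] := eventual_ex (eventual_and ev0 e); case: (h' h).
suff : size (map u s) <= n by rewrite size_map leqNgt ns.
apply: am.
  rewrite map_inj_in_uniq// => i j /sN iN /sN jN E.
  by case: (ltngtP i j) => // ij; [case: (fu i j)|case: (fu j i)]; rewrite ?ij.
by move=> _ /mapP[i si ->]; apply: (Hu (SeqSub si)).
Qed.

Lemma stable_Morley : stable_sequence c.
Proof.
apply: at_most_stable => Y phi.
have D := definable_formula A phi.
have [n Hn] := stable_at_most st D; exists n => b.
case: (eventual_dec st D b) => e.
  by right; apply: (stable_Morley_at_most D Hn).
left; have H : at_most n [set i | ~ ~ sat (vcat (c i) b) phi].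
  apply: (stable_Morley_at_most (definable_not D) _ e) => v.
  by rewrite or_comm; move: (Hn v); rewrite setCK.
by move=> s us sP; apply: H => // i /sP /= h; apply.
Qed.

Lemma lim_stable_Morley : lim_type c (limit_type a).
Proof.
move=> phi e; have D := definable_formula A phi.
have [n Hn] := stable_at_most st D.
apply: eventual_imp (at_most_cofinite (stable_Morley_at_most D Hn e)) _ => i.
exact: contrapT.
Qed.

End StableMorley.

Lemma same_type_definable M V (b b' : V -> U) :
  (forall P, definable M P -> P b -> P b') ->
  forall P, definable M P -> P b' -> P b.
Proof.
move=> H P D Pb'; apply: contrapT => nPb; exact: (H _ (definable_not D) nPb).
Qed.

Lemma same_typeP M (Z : finType) (b b' : Z -> U) :
  same_type id M b b' <-> forall P, definable M P -> P b <-> P b'.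
Proof.
split=> [H P /definable_inst[Y [phi [c [cM E]]]]|H Y phi c cM].
  by rewrite -!E; apply: H.
exact: (H (fun b => sat (vcat b c) phi)) (definable_sat _ cM).
Qed.

Lemma invariant_limit_type X (a : nat -> X -> U) M :
  stable_sequence a -> (forall i x, M (a i x)) -> Defs.invariant M (limit_type a).
Proof.
move=> st aM Y phi b b' /same_typeP H.
have E c : limit_type a (inst phi c) <-> eventual (fun i => sat (vcat (a i) c) phi).
  by split=> e; apply: eventual_imp e _ => i; rewrite sat_inst.
rewrite !E; apply: (H (fun b => eventual (fun i => sat (vcat (a i) b) phi))).
exact: (definable_eventual st aM (definable_formula M phi)).
Qed.

Lemma generically_stable_limit_type K (hK : card_lt K [set: formula L nat]) X
    (a : nat -> X -> U) :
  stable_sequence a -> generically_stable K (limit_type a).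
Proof.
move=> st; have [M sM Ma] := small_model_through (U := U) hK (flat a).
have aM i x : M (a i x) by apply: (Ma (i, x)).
exists M; split=> //; first exact: invariant_limit_type.
by move=> c; apply: lim_stable_Morley.
Qed.

End LimitTypes.

(** * Morley sequences of generically stable types *)

Section InvariantMorley.
Variables (L : language) (U : structure L) (X : finType) (M : set U).
Variable p : set (formula L (X + U)).
Hypotheses (gp : global_type p) (pM : Defs.invariant M p).

Definition initial W n (s : nat -> W -> U) (x : 'I_n * W) : U := s x.1 x.2.

Lemma earlier_range (W : finType) (s : nat -> W -> U) n :
  earlier s n = range (initial (n := n) s).
Proof.
apply/seteqP; split=> u.
  by move=> [j jn [x ->]]; exists (Ordinal jn, x).
by move=> [[i x] _ <-]; exists i => //; exists x.
Qed.

Lemma definable_initial A (W : finType) (P : (nat * W -> U) -> Prop) :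
  definable A P -> exists n (Q : ('I_n * W -> U) -> Prop),
    definable A Q /\ forall s, P (flat s) <-> Q (initial s).
Proof.
move=> D.
have D' : definable A (fun v : void + nat * W -> U => P (v \o inr)).
  exact: definable_rename.
have [Y [c [Q [DQ E]]]] := definable_support D'.
pose n := (\max_(y : Y) (c y).1).+1.
have cn y : (c y).1 < n by rewrite ltnS; apply: (leq_bigmax y).
exists n, (fun v => Q (vcat (of_void U) (fun y => v (Ordinal (cn y), (c y).2)))).
split; last by move=> s; apply: (E (of_void U) (flat s)).
apply: eq_definable (definable_rename (fun y : void + Y => match y with inl x => of_void _ x
   | inr y => (Ordinal (cn y), (c y).2) end) DQ) => v; apply: eq_iff.
by apply/funext; case.
Qed.

(** Invariance concerns finite tuples; a definable relation sees only finitely many coordinates of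
    [z] and [z'], so it extends to tuples of any length. *)
Lemma holds_transfer (Z : Type) (z z' : Z -> U) (P : (X + Z -> U) -> Prop) :
  definable M P -> (forall Q, definable M Q -> Q z -> Q z') ->
  holds p (fun w => P (vcat w z)) -> holds p (fun w => P (vcat w z')).
Proof.
move=> [phi H] zz'.
have [Y [c [psi E]]] := formula_support (formula_map (fun x : X + Z + {u | M u} =>
   match x with inl (inl x) => inl x | inl (inr v) => inr (inl v)
   | inr u => inr (inr u) end) phi).
have HP w y : sat (vcat w (vcat y sval \o c)) psi <-> P (vcat w y).
  rewrite -H.
  transitivity (sat (vcat w (vcat y sval)) (formula_map (vcat inl (inr \o c)) psi)).
    by rewrite sat_map; apply: (eq_iff (fun w => sat w psi)); apply/funext; case.
  rewrite -E sat_map; apply: (eq_iff (fun w => sat w phi)).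
  by apply/funext => -[[]|].
rewrite -(holds_inst gp (HP^~ z)) -(holds_inst gp (HP^~ z')).
suff st : same_type id M (vcat z sval \o c) (vcat z' sval \o c).
  by case: (pM psi st).
apply: (iffRL (same_typeP _ _ _)) => Q DQ.
have DQ' : definable M (fun y : Z -> U => Q (vcat y sval \o c)).
  exact: definable_subst.
by split; [apply: (zz' _ DQ')|apply: (same_type_definable zz' DQ')].
Qed.

(** By induction on the length: the condition on the last term of [c] is in [p], invariance moves
    its parameters to the earlier terms of [c'], and the next term of [c'] realizes it. *)
Lemma Morley_initial c c' : Morley_sequence M p c -> Morley_sequence M p c' ->
  forall n (P : ('I_n * X -> U) -> Prop), definable M P ->
    P (initial c) -> P (initial c').
Proof.
move=> Mc Mc'; elim=> [|n IH] P D Pc.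
  by apply: (iffLR (eq_iff _ _)) Pc; apply/funext => -[[]].
pose g (x : 'I_n.+1 * X) : X + 'I_n * X :=
  if unlift ord_max x.1 is Some j then inr (j, x.2) else inl x.2.
pose P0 v := P (v \o g).
have D0 : definable M P0 by apply: definable_rename.
have E s : P0 (vcat (s n) (initial s)) <-> P (initial s).
  rewrite /P0; apply: (eq_iff P); apply/funext => -[i x]; rewrite /g /=.
  case: unliftP => [j ->|->] //=; rewrite /initial /=.
  by rewrite /bump leqNgt ltn_ord.
have Dfix s : definable (M `|` earlier s n) (fun w => P0 (vcat w (initial s))).
  apply: definable_fix; last by apply: definable_subset D0; left.
  by move=> [i x]; right; exists i => //; exists x.
apply/E; apply: (iffLR (MorleyP _ _ gp) Mc' n _ (Dfix c')).
apply: (holds_transfer D0 (IH)); apply: (Morley_holds gp Mc (Dfix c)).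
exact/E.
Qed.

Lemma Morley_elementary c c' (P : (nat * X -> U) -> Prop) :
  Morley_sequence M p c -> Morley_sequence M p c' -> definable M P ->
  P (flat c) -> P (flat c').
Proof.
move=> Mc Mc' /definable_initial[n [Q [D E]]] /E Pc.
by apply/E; apply: (Morley_initial Mc Mc' D Pc).
Qed.

Lemma elementary_Morley c c' : Morley_sequence M p c ->
  (forall P, definable M P -> P (flat c) -> P (flat c')) -> Morley_sequence M p c'.
Proof.
move=> Mc cc'; apply/(MorleyP _ _ gp) => n P.
rewrite earlier_range => /definable_unparam[Q [DQ E]] hP.
have hQ : holds p (fun w => Q (vcat w (initial (n := n) c'))).
  by have [psi pp H] := hP; exists psi => // a; rewrite H.
have tr R : definable M R -> R (initial (n := n) c) -> R (initial (n := n) c').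
  move=> DR; apply: (cc' (fun v => R (fun x => v (val x.1, x.2)))).
  exact: (definable_rename (fun x : 'I_n * X => (val x.1, x.2))).
have hQ' := holds_transfer DQ (same_type_definable tr) hQ.
apply/E; apply: (cc' (fun v => Q (vcat (fun x => v (n, x)) (fun x => v (val x.1, x.2))))).
  apply: eq_definable (definable_rename (fun x : X + 'I_n * X => match x with
     inl x => (n, x) | inr x => (val x.1, x.2) end) DQ) => v; apply: eq_iff.
  by apply/funext; case.
apply: (iffLR (MorleyP _ _ gp) Mc n (fun w => Q (vcat w (initial (n := n) c)))) => //.
apply: definable_fix; last by apply: definable_subset DQ; left.
by move=> [i x]; right; exists i => //; exists x.
Qed.

End InvariantMorley.

Lemma not_at_most_increasing n S : ~ at_most n S ->
  exists u : nat -> nat, {homo u : i j / i < j} /\ forall k, k < n -> S (u k).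
Proof.
move=> nam; apply: contrapT => nu; apply: nam => s us sS.
rewrite leqNgt; apply/negP => ns; apply: nu.
pose t := sort leq s.
have st : sorted ltn t by rewrite ltn_sorted_uniq_leq sort_uniq us sort_sorted//; apply: leq_total.
have szt : size t = size s by rewrite size_sort.
(* The sorted list supplies the indices up to [n]; beyond it, adding [k] keeps the sequence strictly
   increasing. *)
exists (fun k => if k <= n then nth 0 t k else nth 0 t n + k); split.
  have tm i j : i < j -> j <= n -> nth 0 t i < nth 0 t j.
    move=> ij jn; apply: (sorted_ltn_nth ltn_trans) => //; rewrite inE szt; lia.
  have tm' i : i <= n -> nth 0 t i <= nth 0 t n.
    by rewrite leq_eqVlt => /orP[/eqP->//|/tm/(_ (leqnn n))/ltnW].
  move=> i j ij; case: (leqP i n) => i_n; case: (leqP j n) => j_n; last by lia.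
  - exact: tm.
  - by have := tm' _ i_n; lia.
  - lia.
move=> k kn; rewrite (ltnW kn); apply: sS.
by rewrite -(mem_sort leq); apply: mem_nth; rewrite szt; lia.
Qed.

Section GenericallyStableMorley.
Variables (L : language) (U : structure L) (K : Type).
Hypothesis hK : card_lt K [set: formula L nat].
Hypothesis hS : saturated K U.

(* If [phi] splits a Morley sequence into two arbitrarily large parts, then
   saturation yields two Morley sequences and a parameter for which [phi]
   holds along the first one only; both converge to [p]. *)
Lemma generically_stable_Morley (X : finType) (M : set U)
    (p : set (formula L (X + U))) c :
  global_type p -> card_lt K M -> Defs.invariant M p ->
  generically_stable_over M p -> Morley_sequence M p c -> stable_sequence c.
Proof.
move=> gp KM pM gs Mc; apply: at_most_stable => Y phi; apply: contrapT => nst.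
have split_ n : exists b u u', [/\ {homo u : i j / i < j}, {homo u' : i j / i < j},
    forall k, k < n -> sat (vcat (c (u k)) b) phi &
    forall k, k < n -> ~ sat (vcat (c (u' k)) b) phi].
  apply: contrapT => nb; apply: nst; exists n => b; apply: contrapT => /not_orP.
  move=> [/not_at_most_increasing[u [um uP]] /not_at_most_increasing[u' [um' uP']]].
  by apply: nb; exists b, u, u'.
(* One sequence of tuples carries both Morley sequences and the parameter, which is read at index 0.
   The conditions [inl] impose on both sequences the type of [c] over [M], and [inr k] says that
   [phi] separates their terms of index [k]. *)
pose W : finType := ((X + X) + Y)%type.
pose P (i : {P : (nat * X -> U) -> Prop | definable M P /\ P (flat c)} + nat)
    (v : nat * W -> U) := match i with
  | inl Q => sval Q (fun x => v (x.1, inl (inl x.2))) /\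
             sval Q (fun x => v (x.1, inl (inr x.2)))
  | inr k => sat (vcat (fun x => v (k, inl (inl x))) (fun y => v (0, inr y))) phi /\
           ~ sat (vcat (fun x => v (k, inl (inr x))) (fun y => v (0, inr y))) phi
  end.
have [||s sP] := saturated_sequence hK hS (P := P) KM.
- move=> [[Q [D Qc]]|k] /=; apply: definable_and.
  + exact: (definable_rename (fun x : nat * X => (x.1, inl (inl x.2)))).
  + exact: (definable_rename (fun x : nat * X => (x.1, inl (inr x.2)))).
  + apply: eq_definable (definable_rename (fun x : X + Y => match x with
      inl x => (k, inl (inl x)) | inr y => (0, inr y) end) (definable_formula M phi)) => v.
    by apply: (eq_iff (fun w => sat w phi)); apply/funext; case.
  + apply: definable_not.
    apply: eq_definable (definable_rename (fun x : X + Y => match x with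
      inl x => (k, inl (inr x)) | inr y => (0, inr y) end) (definable_formula M phi)) => v.
    by apply: (eq_iff (fun w => sat w phi)); apply/funext; case.
(* Finitely many conditions are met by two increasing subsequences of [c], which are again Morley
   sequences and so have the same type over [M]. *)
- move=> J G; pose n := (\max_(j : J) (if G j is inr k then k else 0)).+1.
  have [b [u [u' [um um' uP uP']]]] := split_ n.
  exists (fun k => vcat (vcat (c (u k)) (c (u' k))) b) => j.
  case E : (G j) => [[Q [D Qc]]|k] /=.
    by split; apply: (Morley_elementary gp pM Mc (Morley_subseq _ Mc) D Qc).
  have kn : k < n.
    by rewrite ltnS; apply: leq_trans (leq_bigmax j); rewrite E.
  by split; [apply: uP|apply: uP'].
pose d k x := s k (inl (inl x)); pose e k x := s k (inl (inr x)).
pose b y := s 0 (inr y).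
have Md : Morley_sequence M p d.
  apply: (elementary_Morley gp pM Mc) => Q D Qc.
  by have [] := sP (inl (exist _ Q (conj D Qc))).
have Me : Morley_sequence M p e.
  apply: (elementary_Morley gp pM Mc) => Q D Qc.
  by have [] := sP (inl (exist _ Q (conj D Qc))).
have sb a : sat (vcat a id) (inst phi b) = sat (vcat a b) phi by rewrite sat_inst.
case: (proj2 gp (inst phi b)).
  move=> /(gs e Me)/eventual_ex[k]; rewrite sb.
  by have [_] := sP (inr k).
move=> /(gs d Md)/eventual_ex[k] /=; rewrite sb.
by have [+ _] := sP (inr k) => h; apply.
Qed.

Lemma generically_stable_limit (X : finType) (p : set (formula L (X + U))) :
  global_type p -> generically_stable K p ->
  exists2 a, stable_sequence a & p = limit_type a.
Proof.
move=> gp [M [[KM _] pM gs]].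
have [a Ma] := exists_Morley hK hS gp KM.
exists a; first exact: generically_stable_Morley Ma.
exact/lim_type_eq/gs.
Qed.

End GenericallyStableMorley.

(** * Tensor products *)

Section Ultrapower.
Variables (L : language) (U : structure L) (I : Type) (F : set (set I)).
Hypothesis FU : UltraFilter F.

Lemma filter_forall_fin (J : finType) (S : J -> set I) :
  (forall j, F (S j)) -> F [set i | forall j, S j i].
Proof.
move=> H; suff D (s : seq J) : F [set i | forall j, j \in s -> S j i].
  by apply: filterS (D (enum J)) => i Hi j; apply: Hi; rewrite mem_enum.
elim: s => [|j s IH]; first by apply: filterS filterT => i.
apply: filterS (filterI (H j) IH) => i [h h'] k.
by rewrite inE => /orP[/eqP->|/h'].
Qed.

Lemma ultra_not (S : set I) : F (~` S) <-> ~ F S.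
Proof.
split=> [h h'|h]; last by case: (in_ultra_setVsetC S FU).
apply: (@filter_not_empty _ F _).
by apply: filterS (filterI h h') => i [].
Qed.

(** A class of functions modulo equality almost everywhere is encoded as the set of its members. *)
Definition germ (f : I -> U) : set (I -> U) := [set g | F [set i | f i = g i]].

Definition ultra_carrier := {A : set (I -> U) | exists f, A = germ f}.

Definition ultra_class (f : I -> U) : ultra_carrier := exist _ (germ f) (ex_intro _ f erefl).

Definition ultra_rep (x : ultra_carrier) : I -> U := projT1 (cid (svalP x)).

Lemma ultra_classE f g : ultra_class f = ultra_class g <-> F [set i | f i = g i].
Proof.
split=> [/(congr1 sval)/= E|fg].
  have : germ g g by apply: filterS filterT => i.
  by rewrite -E.
apply/eq_exist/seteqP; split=> k; apply: filterS2 fg => i /=; first by move=> ->.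
by move=> -> ->.
Qed.

Lemma ultra_repK x : ultra_class (ultra_rep x) = x.
Proof.
by case: x => A H; rewrite /ultra_rep; case: cid => f /= E; apply/eq_exist.
Qed.

Lemma ultra_classK f : F [set i | ultra_rep (ultra_class f) i = f i].
Proof. by apply/ultra_classE; rewrite ultra_repK. Qed.

Lemma ultra_inhabited : inhabited ultra_carrier.
Proof. by have [u] := carrier_inhabited U; apply: inhabits (ultra_class (fun=> u)). Qed.

Definition ultrapower : structure L :=
  @Structure L ultra_carrier ultra_inhabited
    (fun f x => ultra_class (fun i => fint (fun k => ultra_rep (x k) i)))
    (fun r x => F [set i | rint (fun k => ultra_rep (x k) i)]).

Lemma eval_ultrapower V (t : term L V) (v : V -> I -> U) :
  @eval L ultrapower V (fun x => ultra_class (v x)) t =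
  ultra_class (fun i => eval (v^~ i) t).
Proof.
elim: t => //= f ts IH; apply/ultra_classE.
have := filter_forall_fin (fun k => ultra_classK (fun i => eval (v^~ i) (ts k))).
apply: filterS => i /= H; congr fint; apply/funext => k.
by rewrite IH; apply: H.
Qed.

Lemma Los V (phi : formula L V) (v : V -> I -> U) :
  @sat L ultrapower V (fun x => ultra_class (v x)) phi <->
  F [set i | sat (v^~ i) phi].
Proof.
elim: phi v => {V} [V|V s t|V r ts|V p IHp q IHq|V p IH] v /=.
- split=> // h; apply: (@filter_not_empty _ F _); exact: filterS h.
- by rewrite !eval_ultrapower ultra_classE.
- have E := filter_forall_fin (fun k => ultra_classK (fun i => eval (v^~ i) (ts k))).
  under eq_fun do under eq_fun do rewrite eval_ultrapower.
  by split; apply: filterS2 E => i /= E;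
    (suff -> : (fun k => ultra_rep (ultra_class (fun i => eval (v^~ i) (ts k))) i)
      = (fun k => eval (v^~ i) (ts k)) by []); apply/funext.
- rewrite IHp IHq; split=> [h|h h']; last by apply: filterS2 h h' => i /=; apply.
  case: (EM (F [set i | sat (v^~ i) p])) => [/h|/ultra_not]; apply: filterS => i //=.
- split=> [H|H a]; last first.
    rewrite -(ultra_repK a).
    have -> : (fun o : option V => if o is Some x then ultra_class (v x)
      else ultra_class (ultra_rep a)) =
      (fun o => ultra_class (if o is Some x then v x else ultra_rep a)).
      by apply/funext; case.
    apply/IH; apply: filterS H => i /(_ (ultra_rep a i)).
    by apply: (iffLR (eq_iff (fun w => sat w p) _)); apply/funext; case.
  have [u0] := carrier_inhabited U.
  (* At each index [g] picks a counterexample to [p] if there is one; hence wherever [p] holds at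
     [g], the universal formula holds. *)
  have wit i : exists u, ~ sat (fun o => if o is Some x then v x i else u) p \/
     forall u, sat (fun o => if o is Some x then v x i else u) p.
    case: (EM (exists u, ~ sat (fun o => if o is Some x then v x i else u) p)).
      by move=> [u nu]; exists u; left.
    by move=> n; exists u0; right=> u; apply: contrapT => nu; apply: n; exists u.
  have [g gP] := choice wit.
  have := H (ultra_class g).
  have -> : (fun o : option V => if o is Some x then ultra_class (v x)
      else ultra_class g) = (fun o => ultra_class (if o is Some x then v x else g)).
    by apply/funext; case.
  move=> /IH; apply: filterS => i h; case: (gP i) => // n u; case: n.
  by apply: (iffLR (eq_iff (fun w => sat w p) _)) h; apply/funext; case.
Qed.

Lemma elementary_ultrapower :
  elementary (fun u : U => ultra_class (fun=> u) : ultrapower).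
Proof.
move=> X phi a; rewrite [X in _ <-> X](Los phi (fun x _ => a x)); split=> h.
  exact: filterS filterT.
by apply: contrapT => n; apply: (@filter_not_empty _ F _); apply: filterS h.
Qed.

End Ultrapower.

(** * The tensor product of two limits as an iterated limit *)

Section Tensor.
Variables (L : language) (U : structure L) (K : Type).
Hypothesis hK : card_lt K [set: formula L nat].
Hypothesis hS : saturated K U.
Variables (X Y : finType) (a : nat -> X -> U) (b : nat -> Y -> U).
Hypotheses (sa : stable_sequence a) (sb : stable_sequence b).

(** The outer quantifier is for [b], which is realized first; the inner one is for [a], generic over
    the monster and [b]. *)
Definition tensor_limit : set (formula L ((X + Y)%type + U)) :=
  [set phi | eventual (fun j => eventual (fun i =>
     sat (vcat (vcat (a i) (b j)) id) phi))].

Lemma tensor_limit_dec A V (P : ((X + Y) + V -> U) -> Prop) v : definable A P ->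
  eventual (fun j => eventual (fun i => P (vcat (vcat (a i) (b j)) v))) \/
  eventual (fun j => eventual (fun i => ~ P (vcat (vcat (a i) (b j)) v))).
Proof.
move=> /definableT D.
pose g (x : (X + Y) + V) : X + (Y + V) := match x with inl (inl x) => inl x
   | inl (inr y) => inr (inl y) | inr v => inr (inr v) end.
have D' := definable_rename g D.
have gE x y : vcat x (vcat y v) \o g = vcat (vcat x y) v by apply/funext => -[[]|].
have DE : definable setT (fun w => eventual (fun i => P (vcat (a i) w \o g))).
  exact: (definable_eventual (A := setT) sa (fun _ _ => I) D').
case: (eventual_dec sb DE v) => e; [left|right];
  apply: eventual_imp e _ => j h.
  by apply: eventual_imp h _ => i; rewrite gE.
case: (eventual_dec sa D' (vcat (b j) v)) => e //.
by apply: eventual_imp e _ => i; rewrite gE.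
Qed.

Lemma global_tensor_limit : global_type tensor_limit.
Proof.
split=> [k F FS|phi].
  have [j /eventual_forall/eventual_ex[i H]] := eventual_ex (eventual_forall FS).
  by exists (vcat (a i) (b j)).
exact: (tensor_limit_dec id (definable_formula set0 phi)).
Qed.

Lemma holds_tensor_limit (P : (X + Y -> U) -> Prop) : definable setT P ->
  holds tensor_limit P <->
  eventual (fun j => eventual (fun i => P (vcat (a i) (b j)))).
Proof.
move=> D; split=> [[psi e E]|e].
  by apply: eventual_imp e _ => j e; apply: eventual_imp e _ => i /E.
have [Z [phi [c [_ E]]]] := definable_inst D.
have E' w : sat (vcat w id) (inst phi c) <-> P w by rewrite sat_inst.
exists (inst phi c) => //; apply: eventual_imp e _ => j e.
by apply: eventual_imp e _ => i /E'.
Qed.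

(** The classes of (j,i) -> a_i and (j,i) -> b_j are the required realizations in an ultrapower
    whose ultrafilter extends the Fubini product of the cofinite filter with itself. *)
Lemma tensor_limit_subset : tensor_limit `<=` tensor K (limit_type a) (limit_type b).
Proof.
move=> phi tphi.
pose Fub : set (set (nat * nat)) :=
  [set S | eventual (fun j => eventual (fun i => S (j, i)))].
have FP : ProperFilter Fub.
  split; first by move=> /eventual_ex[j /eventual_ex[]].
  split; first by apply: eventual_all => j; apply: eventual_all.
    move=> S S' e e'; apply: eventual_imp (eventual_and e e') _ => j [].
    exact: eventual_and.
  move=> S S' SS e; apply: eventual_imp e _ => j e.
  by apply: eventual_imp e _ => i; apply: SS.
have [F [FU FubF]] := ultraFilterLemma FP.
pose N := ultrapower U F.
pose h u : N := ultra_class F (fun=> u : U).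
pose as_ x : N := ultra_class F (fun ji => a ji.2 x).
pose bs y : N := ultra_class F (fun ji => b ji.1 y).
have [M sM Ma] := small_model_through (U := U) hK (flat a).
have aM i x : M (a i x) by apply: (Ma (i, x)).
exists N, h, as_, bs; split.
- exact: elementary_ultrapower.
- move=> psi e.
  have -> : vcat bs h = fun z => ultra_class F (fun ji => vcat (b ji.1) id z).
    by apply/funext; case.
  apply/Los; apply: FubF; apply: eventual_imp e _ => j e.
  apply: eventual_all => i; apply: (iffLR (eq_iff (fun w => sat w psi) _)) e.
  by apply/funext; case.
- exists M; split=> //; first exact: invariant_limit_type.
  move=> Z psi d d' dB dd' pd'.
  (* Elements of the monster and of [b] are germs of functions of [j] alone: for fixed [j] the
     parameters stay put while [i] grows. *)
  have /choice[g gE] : forall z, exists g : nat -> U,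
      d z = ultra_class F (fun ji => g ji.1).
    move=> z; case: (dB z) => [[u _ <-]|[y _ <-]]; first by exists (fun=> u).
    by exists (fun j => b j y).
  (* The definition [theta] of [p] for the formula [psi] is over [M], so it passes from [d'] to [d]
     and holds at almost all indices. *)
  have D : definable M (fun v : Z -> U => eventual (fun i => sat (vcat (a i) v) psi)).
    exact: (definable_eventual sa aM (definable_formula M psi)).
  have [Z' [theta [e [eM E]]]] := definable_inst D.
  have ev : eventual (fun i => sat (vcat (a i) d') psi).
    by apply: eventual_imp pd' _ => i; rewrite sat_inst.
  have := iffLR (dd' _ theta e eM) (iffRL (E d') ev).
  have -> : vcat d (h \o e) = fun z => ultra_class F (fun ji => vcat (g^~ ji.1) e z).
    by apply/funext => -[z|z] //=; rewrite gE.
  move=> /Los F1.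
  have F2 : F [set ji | eventual (fun i => sat (vcat (a i) (g^~ ji.1)) psi) ->
      sat (vcat (a ji.2) (g^~ ji.1)) psi].
    apply: FubF; apply: eventual_all => j /=.
    case: (EM (eventual (fun i => sat (vcat (a i) (g^~ j)) psi))) => [e'|ne].
      by apply: eventual_imp e' _.
    exact: eventual_all.
  have -> : vcat as_ d = fun z => ultra_class F (fun ji => vcat (a ji.2) (g^~ ji.1) z).
    by apply/funext => -[z|z] //=; rewrite gE.
  apply/Los; apply: filterS2 F1 F2 => ji /= h1 h2.
  have : sat (vcat (a ji.2) (g^~ ji.1)) psi.
    apply: h2; apply/E; apply: (iffLR (eq_iff (fun w => sat w theta) _)) h1.
    by apply/funext; case.
  by apply: (iffLR (eq_iff (fun w => sat w psi) _)); apply/funext; case.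
- have -> : vcat (vcat as_ bs) h =
     fun z => ultra_class F (fun ji => vcat (vcat (a ji.2) (b ji.1)) id z).
    by apply/funext => -[[]|].
  apply/Los; apply: FubF; apply: eventual_imp tphi _ => j e.
  apply: eventual_imp e _ => i; apply: (iffLR (eq_iff (fun w => sat w phi) _)).
  by apply/funext => -[[]|].
Qed.

(** The realization [bs] of [q] lives in an extension; a realization [b'] of [q] over a small set
    replaces it inside the monster. If [Neg phi] is in the iterated limit, definability of [p] puts
    it in [p] with parameter [b'], hence [as_] satisfies it with parameter [bs], a contradiction. *)
Lemma tensor_subset_limit : tensor K (limit_type a) (limit_type b) `<=` tensor_limit.
Proof.
move=> phi [N [h [as_ [bs [eh bsq [M [[KM _] pM pN]] sphi]]]]].
case: (proj2 global_tensor_limit phi) => // nphi; exfalso.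
have [Z [c [phi0 E]]] := inst_support phi; subst phi.
pose r (x : (X + Y) + Z) : X + (Y + Z) := match x with inl (inl x) => inl x
   | inl (inr y) => inr (inl y) | inr v => inr (inr v) end.
pose phi1 := formula_map r phi0.
(* The set [M] comes with the realization [as_] and need not contain the terms of [a], which are
   added because they define the limit of [a]. *)
pose A := M `|` range c `|` range (flat a).
have KA : card_lt K A.
  apply: (card_lt_setU hK); last exact: countable_range.
  apply: (card_lt_setU hK) => //.
  by apply: finite_set_countable; apply: finite_image; apply: finite_finset.
have [b' rb'] := exists_realizes hS (global_limit_type sb) KA.
have transfer (Z' : finType) (rho : formula L (Y + Z')) (f : Z' -> U) :
    (forall z, A (f z)) -> sat (vcat b' f) rho <-> sat (vcat bs (h \o f)) rho.
  move=> fA.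
  have hN psi : sat (vcat bs h) (inst psi f) <-> sat (vcat bs (h \o f)) psi.
    by rewrite sat_map; apply: (eq_iff (fun w => sat w psi)); apply/funext; case.
  have hp psi : limit_type b (inst psi f) -> sat (vcat b' f) psi.
    by move=> q; have := rb' _ q; rewrite sat_inst; apply; exists Z', psi, f.
  have hp' psi : limit_type b (inst psi f) -> sat (vcat bs (h \o f)) psi.
    by move=> q; apply/hN; apply: bsq.
  case: (proj2 (global_limit_type sb) (inst rho f)) => q.
    by split=> _; [apply: hp'|apply: hp].
  have q' : limit_type b (inst (Neg rho) f) by [].
  by split=> s; [case: (hp _ q' s)|case: (hp' _ q' s)].
have st : same_type h M (vcat b' c) (vcat bs (h \o c)).
  move=> Z' rho f fM.
  pose rho' := formula_map (fun x : (Y + Z) + Z' => match x with inl (inl y) => inl y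
    | inl (inr z) => inr (inl z) | inr z => inr (inr z) end) rho.
  have := transfer _ rho' (vcat c f).
  rewrite !sat_map => T.
  have {}T := T _; rewrite (_ : vcat (vcat b' c) f = vcat b' (vcat c f) \o
    (fun x : (Y + Z) + Z' => match x with inl (inl y) => inl y
    | inl (inr z) => inr (inl z) | inr z => inr (inr z) end)); last first.
    by apply/funext => -[[]|].
  rewrite T; last first.
    by case=> [z|z]; [left; right; exists z|left; left; apply: fM].
  by apply: (eq_iff (fun w => sat w rho)); apply/funext => -[[]|].
have D : definable (range (flat a))
    (fun v : Y + Z -> U => eventual (fun i => ~ sat (vcat (a i) v) phi1)).
  apply: (definable_eventual sa (P := fun w => ~ sat w phi1)).
    by move=> i x; exists (i, x).
  exact: definable_not (definable_formula _ phi1).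
have Dq : definable A (fun v : Y -> U =>
    eventual (fun i => ~ sat (vcat (a i) (vcat v c)) phi1)).
  apply: (definable_fix (P := fun v : Y + Z -> U =>
    eventual (fun i => ~ sat (vcat (a i) v) phi1))).
    by move=> z; left; right; exists z.
  by apply: definable_subset D; right.
have rE x y : sat (vcat x (vcat y c)) phi1 <-> sat (vcat (vcat x y) id) (inst phi0 c).
  rewrite sat_inst sat_map; apply: (eq_iff (fun w => sat w phi0)).
  by apply/funext => -[[]|].
have hq : holds (limit_type b) (fun v : Y -> U =>
    eventual (fun i => ~ sat (vcat (a i) (vcat v c)) phi1)).
  apply/holds_limit_type; first exact: definableT Dq.
  apply: eventual_imp nphi _ => j e; apply: eventual_imp e _ => i n /rE.
  exact: n.
have pb' := iffLR (realizesP _ _ (global_limit_type sb)) rb' _ Dq hq.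
have np : sat (vcat as_ (vcat bs (h \o c))) (Neg phi1).
  apply: (pN _ _ _ _ _ st).
    case=> [y|z]; first by right; exists y.
    by left; exists (c z).
  by apply: eventual_imp pb' _ => i n; rewrite sat_inst.
suff s1 : sat (vcat as_ (vcat bs (h \o c))) phi1 by apply: (np s1).
rewrite sat_map; move: sphi; rewrite sat_map; apply: (iffLR (eq_iff (fun w => sat w phi0) _)).
by apply/funext => -[[]|].
Qed.

Lemma tensor_limitE : tensor K (limit_type a) (limit_type b) = tensor_limit.
Proof.
by apply/seteqP; split; [apply: tensor_subset_limit|apply: tensor_limit_subset].
Qed.

Lemma invariant_tensor_limit M : (forall i x, M (a i x)) -> (forall j y, M (b j y)) ->
  Defs.invariant M tensor_limit.
Proof.
move=> aM bM Z phi d d' dd'.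
pose r (x : (X + Y) + Z) : X + (Y + Z) := match x with inl (inl x) => inl x
   | inl (inr y) => inr (inl y) | inr v => inr (inr v) end.
pose P v := eventual (fun j => eventual (fun i =>
  sat (vcat (a i) (vcat (b j) v)) (formula_map r phi))).
have D : definable M P.
  apply: (definable_eventual sb bM (P := fun w => eventual (fun i =>
    sat (vcat (a i) w) (formula_map r phi)))).
  exact: (definable_eventual sa aM (definable_formula M (formula_map r phi))).
have E v : tensor_limit (inst phi v) <-> P v.
  have E i j : sat (vcat (vcat (a i) (b j)) id) (inst phi v) <->
      sat (vcat (a i) (vcat (b j) v)) (formula_map r phi).
    rewrite sat_inst sat_map; apply: (eq_iff (fun w => sat w phi)).
    by apply/funext => -[[]|].
  by split=> e; apply: eventual_imp e _ => j e; apply: eventual_imp e _ => i /E.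
by rewrite !E; apply: (iffLR (same_typeP _ _ _) dd').
Qed.

End Tensor.

(** * From stable ict-patterns to generically stable types *)

Section TensorMorley.
Variables (L : language) (U : structure L) (X Y : finType).
Variables (a : nat -> X -> U) (b : nat -> Y -> U).
Hypotheses (sa : stable_sequence a) (sb : stable_sequence b).
Variable M : set U.
Hypotheses (aM : forall i x, M (a i x)) (bM : forall j y, M (b j y)).
Variables (c : nat -> X -> U) (d : nat -> Y -> U).
Hypothesis Me : Morley_sequence M (tensor_limit a b) (fun i => vcat (c i) (d i)).

Lemma tensor_Morley_at k (P : (X + Y -> U) -> Prop) :
  definable (M `|` (earlier c k `|` earlier d k)) P ->
  eventual (fun j => eventual (fun i => P (vcat (a i) (b j)))) ->
  P (vcat (c k) (d k)).
Proof.
move=> D e; apply: (iffLR (MorleyP _ _ (global_tensor_limit sa sb)) Me).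
  apply: definable_subset D; apply: setUS => u [] [j jk [x ->]]; exists j => //.
    by exists (inl x).
  by exists (inr x).
exact/(holds_tensor_limit _ _ (definableT D)).
Qed.

Lemma tensor_Morley_right k (P : (Y -> U) -> Prop) :
  definable (M `|` (earlier c k `|` earlier d k)) P ->
  eventual (fun j => P (b j)) -> P (d k).
Proof.
move=> D e; apply: (tensor_Morley_at (P := fun v => P (v \o inr))).
  exact: definable_rename.
by apply: eventual_imp e _ => j h; apply: eventual_all.
Qed.

(** The term [c k] is generic even over [d k]. With [d k] turned into a variable y, the implication
    from Q(a_i,y) for all large i to Q(x,y) is definable and lies in the tensor product. *)
Lemma tensor_Morley_left k (P : (X -> U) -> Prop) :
  definable (M `|` (earlier c k `|` earlier d k) `|` range (d k)) P ->
  eventual (fun i => P (a i)) -> P (c k).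
Proof.
move=> /definable_unparam[Q [D E]] e; apply/E.
set A := M `|` _ in D.
have DE : definable A (fun y : Y -> U => eventual (fun i => Q (vcat (a i) y))).
  by apply: (definable_eventual sa) => // i x; left.
apply: (tensor_Morley_at (P := fun v => eventual (fun i => Q (vcat (a i) (v \o inr))) -> Q v)).
- apply: definable_imp => //; exact: definable_rename DE.
- apply: eventual_all => j.
  case: (EM (eventual (fun i => Q (vcat (a i) (b j))))) => h.
    by apply: eventual_imp h _.
  exact: eventual_all.
- by apply: eventual_imp e _ => i /E.
Qed.

Lemma Morley_left : Morley_sequence M (limit_type a) c.
Proof.
apply/(MorleyP _ _ (global_limit_type sa)) => k P D.
move=> /(holds_limit_type _ (definableT D)); apply: tensor_Morley_left.
by apply: definable_subset D => u [h|h]; left; [left|right; left].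
Qed.

Lemma Morley_right : Morley_sequence M (limit_type b) d.
Proof.
apply/(MorleyP _ _ (global_limit_type sb)) => k P D.
move=> /(holds_limit_type _ (definableT D)); apply: tensor_Morley_right.
by apply: definable_subset D => u [h|h]; [left|right; right].
Qed.

Lemma eventual_left (P : (X -> U) -> Prop) : definable setT P ->
  eventual (fun i => P (a i)) -> eventual (fun i => P (c i)).
Proof.
move=> D /(holds_limit_type _ D)[psi e E].
by apply: eventual_imp (lim_stable_Morley sa aM Morley_left e) _ => i /E.
Qed.

Lemma eventual_right (P : (Y -> U) -> Prop) : definable setT P ->
  eventual (fun i => P (b i)) -> eventual (fun i => P (d i)).
Proof.
move=> D /(holds_limit_type _ D)[psi e E].
by apply: eventual_imp (lim_stable_Morley sb bM Morley_right e) _ => i /E.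
Qed.

Lemma eventual_tensor (P : (X + Y -> U) -> Prop) : definable setT P ->
  eventual (fun j => eventual (fun i => P (vcat (a i) (b j)))) ->
  eventual (fun j => eventual (fun i => P (vcat (c i) (d j)))).
Proof.
move=> D e.
have DE : definable setT (fun y : Y -> U => eventual (fun i => P (vcat (a i) y))).
  exact: (definable_eventual (A := setT) sa (fun _ _ => I) D).
apply: eventual_imp (eventual_right DE e) _ => j.
apply: (eventual_left (P := fun x => P (vcat x (d j)))).
exact: (definable_fix (A := setT) (c := d j) (fun _ => I) D).
Qed.

End TensorMorley.

(** By induction, composing with the transposition of [f (x n)] and [y n], which fixes the values
    already prescribed. *)
Lemma bijection_through n (x y : nat -> nat) :
  (forall k l, k < l < n -> x k <> x l /\ y k <> y l) ->
  exists2 f : nat -> nat, bijective f & forall k, k < n -> f (x k) = y k.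
Proof.
elim: n => [|n IH] H; first by exists id => //; exists id.
have [k l /andP[kl ln]|f bf fE] := IH; first by apply: H; rewrite kl ltnS ltnW.
pose s z := if z == f (x n) then y n else if z == y n then f (x n) else z.
have sK : involutive s.
  move=> z; rewrite /s; case: (eqVneq z (f (x n))) => [->|zf].
    by case: eqP => [->//|_]; rewrite eqxx.
  by case: (eqVneq z (y n)) => [->|zy]; rewrite ?eqxx// (negPf zf) (negPf zy).
exists (s \o f); first by apply: bij_comp bf; exists s.
move=> k; rewrite ltnS leq_eqVlt => /orP[/eqP->|kn] /=; first by rewrite /s eqxx.
have [xx yy] : x k <> x n /\ y k <> y n by apply: H; rewrite kn ltnSn.
rewrite /s; case: eqP => [/(bij_inj bf)//|_].
by rewrite fE//; case: eqP.
Qed.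

Section IctPattern.
Variables (L : language) (U : structure L) (K : Type).
Hypothesis hK : card_lt K [set: formula L nat].
Hypothesis hS : saturated K U.

Lemma sat_inst_xy (X Y Z : finType) (phi : formula L ((X + Y)%type + Z))
    (x : X -> U) (y : Y -> U) (z : Z -> U) :
  sat (vcat z id) (inst_xy phi x y) <-> sat (vcat (vcat x y) z) phi.
Proof.
rewrite sat_map; apply: (eq_iff (fun w => sat w phi)).
by apply/funext => -[[]|].
Qed.

Definition diagonalizable (X Y Z : finType) (phi : formula L ((X + Y)%type + Z)) n
    (x : nat -> X -> U) (y : nat -> Y -> U) :=
  exists z : Z -> U, forall kl : 'I_n * 'I_n,
    sat (vcat (vcat (x kl.1) (y kl.2)) z) phi <-> kl.1 = kl.2.

Lemma definable_diagonalizable A V (X Y Z : finType) (phi : formula L ((X + Y)%type + Z)) n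
    (h : nat -> X -> V) (h' : nat -> Y -> V) :
  definable A (fun v : V -> U =>
    diagonalizable phi n (fun k x => v (h k x)) (fun k y => v (h' k y))).
Proof.
apply: (definable_ex (P := fun v : V + Z -> U => forall kl : 'I_n * 'I_n,
    sat (vcat (vcat (fun x => v (inl (h kl.1 x))) (fun y => v (inl (h' kl.2 y))))
      (v \o inr)) phi <-> kl.1 = kl.2)).
apply: definable_forall => kl; apply: definable_iff; last exact: definable_const.
apply: eq_definable (definable_rename (fun x : (X + Y) + Z => match x with
   inl (inl x) => inl (h kl.1 x) | inl (inr y) => inl (h' kl.2 y) | inr z => inr z end)
   (definable_formula A phi)) => v.
by apply: (eq_iff (fun w => sat w phi)); apply/funext => -[[]|].
Qed.

Lemma ict_pattern_not_generically_stable (X Y Z : finType)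
    (phi : formula L ((X + Y)%type + Z)) (a : nat -> X -> U) (b : nat -> Y -> U) :
  stable_ict_pattern phi a b ->
  ~ generically_stable K (tensor K (limit_type a) (limit_type b)).
Proof.
move=> [sa sb ict]; rewrite (tensor_limitE hK hS sa sb) => -[M [[KM _] inv gs]].
have gt := global_tensor_limit sa sb.
pose A := M `|` range (flat a) `|` range (flat b).
have aA i x : A (a i x) by left; right; exists (i, x).
have bA i x : A (b i x) by right; exists (i, x).
have KA : card_lt K A.
  apply: (card_lt_setU hK); last exact: countable_range.
  by apply: (card_lt_setU hK) => //; exact: countable_range.
have [e] := exists_Morley hK hS gt KA.
pose c i x := e i (inl x); pose d i y := e i (inr y).
have -> : e = fun i => vcat (c i) (d i) by apply/funext => i; apply/funext; case.
move=> Me {KA}.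
(* A failure would be a condition over [A], hence would occur for pairs from [a] and [b] with
   distinct indices. A bijection matching these indices then gives a contradiction with the
   pattern. *)
have diag n : diagonalizable phi n c d.
  apply: contrapT => nd.
  pose R (v : nat * (X + Y) -> U) := ~ diagonalizable phi n (fun k x => v (k, inl x))
    (fun k y => v (k, inr y)).
  have DR : definable A R by apply: definable_not; apply: definable_diagonalizable.
  have Rs s s' : (forall k, k < n -> s k = s' k) -> R (flat s) <-> R (flat s').
    move=> ss; rewrite /R /diagonalizable /flat /=.
    split=> h [z zP]; apply: h; exists z => kl; rewrite -zP; by rewrite !ss.
  have [|Q DQ|u [fu Ru]] := Morley_approx (g := fun ij => vcat (a ij.1) (b ij.2))
      (fresh := fun ij kl => ij.1 <> kl.1 /\ ij.2 <> kl.2) (0, 0) gt Me _ _ DR Rs nd.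
  - by move=> [i j] [x|y]; [apply: aA|apply: bA].
  - move=> /(holds_tensor_limit _ _ DQ) ev m u.
    have [j [e1 jm]] := eventual_ex (eventual_and ev (eventual_ge (\max_(l < m) (u l).2).+1)).
    have [i [Qi im]] := eventual_ex (eventual_and e1 (eventual_ge (\max_(l < m) (u l).1).+1)).
    exists (i, j); split=> // l lm; split=> /= E.
      move: im; rewrite E ltnNge.
      by rewrite (leq_bigmax (F := fun l : 'I_m => (u l).1) (Ordinal lm)).
    move: jm; rewrite E ltnNge.
    by rewrite (leq_bigmax (F := fun l : 'I_m => (u l).2) (Ordinal lm)).
  apply: Ru.
  have [f bf fE] := @bijection_through n (fun k => (u k).1) (fun k => (u k).2) fu.
  pose F (s : 'I_#|{: 'I_n * 'I_n}|) := let kl := enum_val s in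
    if f (u kl.1).1 == (u kl.2).2 then inst_xy phi (a (u kl.1).1) (b (u kl.2).2)
    else Neg (inst_xy phi (a (u kl.1).1) (b (u kl.2).2)).
  have [|z zP] := ict f bf _ F; first by move=> s; exists (u (enum_val s).1).1, (u (enum_val s).2).2.
  exists z => -[k l] /=; have := zP (enum_rank (k, l)).
  rewrite /F enum_rankK /= fE//; case: eqP => E.
    move=> /sat_inst_xy h; split=> // _; apply/val_inj => /=.
    case: (ltngtP k l) => // kl.
      by case: (fu k l) => [|_ []]; rewrite ?kl ?ltn_ord.
    by case: (fu l k) => [|_ []]; rewrite ?kl ?ltn_ord.
  move=> h; split=> [/sat_inst_xy /h//|kl]; by case: E; rewrite kl.
pose A' := range (flat c) `|` range (flat d).
have KA' : card_lt K A'.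
  apply: (card_lt_setU hK); last exact: countable_range.
  by apply: (card_lt_countable hK); apply: countable_range.
(* By compactness a single [z] works for all [n] at once. *)
have [||z zP] := saturated_definable hS (P := fun (kl : nat * nat) (z : Z -> U) =>
    sat (vcat (vcat (c kl.1) (d kl.2)) z) phi <-> kl.1 = kl.2) KA'.
- move=> [k l] /=; apply: definable_iff; last exact: definable_const.
  pose r (x : (X + Y) + Z) : Z + (X + Y) := match x with inl v => inr v | inr z => inl z end.
  have D := definable_rename r (definable_formula A' phi).
  have cdA xy : A' (vcat (c k) (d l) xy).
    by case: xy => [x|y]; [left; exists (k, x)|right; exists (l, y)].
  apply: eq_definable (definable_fix cdA D) => v.
  by apply: (eq_iff (fun w => sat w phi)); apply/funext => -[[]|].
- move=> m G; pose n := (\max_(s < m) maxn (G s).1 (G s).2).+1.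
  have [z zP] := diag n; exists z => s.
  have sn : maxn (G s).1 (G s).2 < n by rewrite ltnS; apply: (leq_bigmax s).
  have [k1 l1] : (G s).1 < n /\ (G s).2 < n by move: sn; rewrite gtn_max => /andP[].
  have := zP (Ordinal k1, Ordinal l1); move=> /= ->.
  by split=> [/(congr1 val)//|E]; apply/val_inj.
have MA : M `<=` A by move=> u; left; left.
have lim := gs _ (Morley_subset MA Me).
(* On the diagonal the formula holds at every [k], so convergence excludes its negation from the
   type. *)
have tphi : tensor_limit a b (inst phi z).
  case: (proj2 gt (inst phi z)) => // /lim/eventual_ex[k] /=.
  by rewrite sat_inst => n; case: n; apply/(zP (k, k)).
have ev : eventual (fun j => eventual (fun i =>
    sat (vcat (vcat (a i) (b j)) z) phi)).
  by apply: eventual_imp tphi _ => j h; apply: eventual_imp h _ => i; rewrite sat_inst.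
have D : definable setT (fun v : X + Y -> U => sat (vcat v z) phi).
  exact: definable_sat.
have [j [k kP]] := eventual_ex (eventual_tensor sa sb aA bA Me D ev).
(* An index larger than [j], hence off the diagonal, where the formula should fail. *)
have := kP (maxn k j.+1) (leq_maxl _ _).
move=> /(zP (_, _)) /= E; have := leq_maxr k j.+1; by rewrite E ltnn.
Qed.

End IctPattern.

(** * From generically stable types to stable ict-patterns *)

Section Exchange.
Variables (L : language) (U : structure L) (W : finType) (T : eqType).
Variables (M : set U) (ar : T -> nat -> W -> U) (r : nat -> T) (g : nat -> W -> U).
Hypotheses (st : forall t, stable_sequence (ar t)) (arM : forall t i x, M (ar t i x)).
Hypothesis Mg : forall n P, definable (M `|` earlier g n) P ->
  eventual (fun i => P (ar (r n) i)) -> P (g n).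

Definition supported m (P : (nat * W -> U) -> Prop) :=
  forall s s', (forall k, k < m -> s k = s' k) -> P (flat s) <-> P (flat s').

(* The quantifier "for the generic [x] of type [t], in coordinate [n]". *)
Definition generic t n (P : (nat * W -> U) -> Prop) (v : nat * W -> U) :=
  eventual (fun i => P (fun x => if x.1 == n then ar t i x.2 else v x)).

Lemma genericE t n P s :
  generic t n P (flat s) = eventual (fun i => P (flat (upd s n (ar t i)))).
Proof.
congr eventual; apply/funext => i; congr P; apply/funext => x.
by rewrite /flat /upd; case: ifP.
Qed.

Lemma definable_at A n (P : (nat * W -> U) -> Prop) : definable A P ->
  definable A (fun v : W + nat * W -> U =>
    P (fun x => if x.1 == n then v (inl x.2) else v (inr x))).
Proof.
move=> D; apply: eq_definable (definable_rename
  (fun x : nat * W => if x.1 == n then inl x.2 else inr x) D) => v.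
by apply: (eq_iff P); apply/funext => x /=; case: ifP.
Qed.

Lemma definable_generic t n P : definable M P -> definable M (generic t n P).
Proof. by move=> D; apply: (definable_eventual (st t) (arM t) (definable_at n D)). Qed.

Lemma supported_generic t m n P : supported m P -> supported m (generic t n P).
Proof.
move=> sP s s' ss; rewrite !genericE.
have E i : P (flat (upd s n (ar t i))) <-> P (flat (upd s' n (ar t i))).
  by apply: sP => k km; rewrite /upd; case: ifP => // _; apply: ss.
by split=> e; apply: eventual_imp e _ => i /E.
Qed.

Lemma supported_generic_last t n P : supported n.+1 P -> supported n (generic t n P).
Proof.
move=> sP s s' ss; rewrite !genericE.
have E i : P (flat (upd s n (ar t i))) <-> P (flat (upd s' n (ar t i))).
  apply: sP => k; rewrite ltnS leq_eqVlt /upd; case: eqP => //= _ kn.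
  exact: ss.
by split=> e; apply: eventual_imp e _ => i /E.
Qed.

Lemma generic_dec t n P s : definable M P ->
  eventual (fun i => P (flat (upd s n (ar t i)))) \/
  eventual (fun i => ~ P (flat (upd s n (ar t i)))).
Proof.
move=> D; rewrite -genericE -(genericE t n (fun v => ~ P v)).
exact: (eventual_dec (st t) (definable_at n D) (flat s)).
Qed.

(** The last term realizes a complete type over [M] and its predecessors, so its behaviour is that
    of the generic quantifier. *)
Lemma generic_last n P : definable M P -> supported n.+1 P ->
  P (flat g) <-> generic (r n) n P (flat g).
Proof.
move=> D sP.
have Dn : definable (M `|` earlier g n) (fun x => P (flat (upd g n x))).
  apply: (definable_upd sP); last by apply: definable_subset D; left.
  move=> k x; rewrite ltnS leq_eqVlt => /orP[->//|kn] _.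
  by right; exists k => //; exists x.
rewrite genericE; split=> [Pg|/(Mg Dn)]; last by rewrite upd_id.
case: (generic_dec (r n) n g D) => // /(Mg (definable_not Dn)).
by rewrite upd_id.
Qed.

(* The generic quantifiers for the terms after the [n]th one commute with the
   generic quantifier for the [n]th term. *)
Lemma generic_exchange s n P : definable M P -> supported (n + s).+1 P ->
  P (flat g) -> generic (r n) n P (flat g).
Proof.
elim: s P => [|s IH] P D sP; first by rewrite addn0 in sP; move/(generic_last D sP).
move: sP; rewrite addnS; set m := (n + s).+1 => sP /(generic_last D sP) e.
have nm : (n == m) = false by rewrite /m; apply/eqP; lia.
have := IH _ (definable_generic (r m) m D) (supported_generic_last (r m) sP) e.
rewrite genericE => e2.
have updC x y : upd (upd g n x) m y = upd (upd g m y) n x.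
  apply/funext => k; rewrite /upd; case: eqP => [->|//].
  by rewrite eq_sym nm.
(* After the last term has been quantified away and the induction hypothesis applied, the two
   quantifiers are exchanged by stability, and the outer one is absorbed by the last term again. *)
have swap : eventual (fun j => eventual (fun i =>
    P (flat (upd (upd g m (ar (r m) j)) n (ar (r n) i))))).
  have [N HN] := stable_at_most (st (r n)) (definable_at n D).
  have fE w v x : (fun x0 => if x0.1 == n then vcat w (flat v) (inl x0.2)
      else vcat w (flat v) (inr x0)) x = flat (upd v n w) x.
    by rewrite /flat /upd /=; case: ifP.
  apply: (eventual_swap (n := N)).
    move=> j; have := HN (flat (upd g m (ar (r m) j))).
    suff -> : [set i | P (fun x => if x.1 == n then vcat (ar (r n) i) (flat (upd g m (ar (r m) j))) (inl x.2)
      else vcat (ar (r n) i) (flat (upd g m (ar (r m) j))) (inr x))] =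
      [set i | P (flat (upd (upd g m (ar (r m) j)) n (ar (r n) i)))] by [].
    apply/funext => i; congr P; apply/funext => x; exact: fE.
  apply: eventual_imp e2 _ => i; rewrite genericE => e3.
  by apply: eventual_imp e3 _ => j; rewrite updC.
have D' := definable_generic (r n) n D.
have sP' := supported_generic (r n) n sP.
apply/(generic_last D' sP'); rewrite genericE.
by apply: eventual_imp swap _ => j; rewrite genericE.
Qed.

(** Each term is generic over all the others, including the later ones. *)
Lemma generic_others n P : definable M P -> P (flat g) ->
  eventual (fun i => P (flat (upd g n (ar (r n) i)))).
Proof.
move=> D Pg; have [m sP] := definable_finite_support D.
rewrite -genericE; apply: (generic_exchange (s := m)) => // s s' ss.
by apply: sP => k km; apply: ss; lia.
Qed.

Hypothesis cofinal_r : forall n N, exists2 k, N <= k & r k = r n.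
Hypothesis lim_g : forall n P, definable setT P ->
  eventual (fun i => P (ar (r n) i)) -> eventual (fun k => r k = r n -> P (g k)).

(* Both tuples are moved, one coordinate at a time, to the same fresh tuple. *)
Lemma generic_indiscernible N (u v : nat -> nat) R :
  definable M R -> supported N R ->
  (forall k l, k < l < N -> u k <> u l) -> (forall k l, k < l < N -> v k <> v l) ->
  (forall k, k < N -> r (u k) = r (v k)) ->
  R (flat (g \o u)) -> R (flat (g \o v)).
Proof.
move=> D sR iu iv ruv Ru; apply: contrapT => Rv.
(* Entry [m] is generic over the other entries, so it may become a term of the approximating
   sequence, and by [lim_g] any late term of [g] of the same kind. Injectivity of [w] ensures that
   no other entry changes. *)
have step P (w : nat -> nat) m : definable M P -> supported N P -> m < N ->
    (forall k l, k < l < N -> w k <> w l) -> P (flat (g \o w)) ->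
    eventual (fun k => r k = r (w m) -> P (flat (upd (g \o w) m (g k)))).
  move=> DP sP mN iw Pw.
  have DPw : definable M (fun s => P (fun x => s (w x.1, x.2))).
    exact: (definable_rename (fun x : nat * W => (w x.1, x.2))).
  apply: (lim_g (P := fun x => P (flat (upd (g \o w) m x)))).
    by apply: (definable_upd sP) => //; apply: definableT DP.
  apply: eventual_imp (generic_others (w m) DPw Pw) _ => i.
  apply: (iffLR (sP (fun k => upd g (w m) (ar (r (w m)) i) (w k)) _ _)) => k kN.
  rewrite /upd /=; case: (eqVneq k m) => [->|km]; first by rewrite eqxx.
  case: eqP => // E; exfalso.
  case: (ltngtP k m) => h; [case: (iw k m)|case: (iw m k)|]; rewrite ?h //.
  by move: km; rewrite h eqxx.
(* After [m] moves the index tuples agree below [m], while [R] still separates them; at [N] this is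
   absurd. *)
have : forall m, m <= N -> exists u' v' : nat -> nat,
  [/\ forall k, k < m -> u' k = v' k,
      (forall k l, k < l < N -> u' k <> u' l) /\ (forall k l, k < l < N -> v' k <> v' l),
      forall k, k < N -> r (u' k) = r (v' k),
      R (flat (g \o u')) & ~ R (flat (g \o v'))].
  elim=> [|m IH] mN; first by exists u, v.
  have [u' [v' [uv' [iu' iv'] ruv' Ru' Rv']]] := IH (ltnW mN).
  have eu := step R u' m D sR mN iu' Ru'.
  have nsR : supported N (fun v => ~ R v).
    by move=> s s' ss; have := sR s s' ss; tauto.
  have ev := step _ v' m (definable_not D) nsR mN iv' Rv'.
  pose B := (\max_(k < N) maxn (u' k) (v' k)).+1.
  have uB k : k < N -> u' k < B /\ v' k < B.
    move=> kN; have : maxn (u' k) (v' k) < B by rewrite ltnS; apply: (leq_bigmax (Ordinal kN)).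
    by rewrite gtn_max => /andP[].
  (* One index [k] of the right kind, beyond all those in use, serves for both tuples and keeps them
     injective. *)
  have [k0 H] := eventual_and (eventual_and eu ev) (eventual_ge B).
  have [k k0k rk] := cofinal_r (u' m) k0.
  have [[Ruk Rvk] Bk] := H k k0k.
  have E w : flat (g \o (fun l => if l == m then k else w l)) = flat (upd (g \o w) m (g k)).
    by congr flat; apply/funext => l; rewrite /upd /=; case: ifP.
  have inj w : (forall l, l < N -> w l < B) -> (forall k l, k < l < N -> w k <> w l) ->
      forall l l', l < l' < N -> (if l == m then k else w l) <> (if l' == m then k else w l').
    move=> wB iw l l' /andP[ll' l'N]; have := wB l (ltn_trans ll' l'N).
    have := wB l' l'N; case: eqP => [lm|_]; case: eqP => [lE|_]; try lia.
    by move=> _ _; apply: iw; rewrite ll'.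
  exists (fun l => if l == m then k else u' l), (fun l => if l == m then k else v' l).
  split.
  - by move=> l; rewrite ltnS leq_eqVlt; case: eqP => //= _; apply: uv'.
  - by split; apply: inj => // l /uB[].
  - by move=> l lN; case: eqP => // _; apply: ruv'.
  - by rewrite E; apply: Ruk.
  - by rewrite E; apply: Rvk; rewrite rk ruv'.
move=> /(_ N (leqnn N))[u' [v' [uv' _ _ Ru' []]]].
by apply: (iffLR (sR _ _ _)) Ru' => k kN; rewrite /= uv'.
Qed.

End Exchange.

(** Each new index is taken beyond the threshold [T] of the preceding one, and so beyond those of
    all earlier indices. *)
Lemma increasing_homogeneous (R : nat -> nat -> Prop) k0 :
  (forall i, k0 <= i -> eventual (fun j => R i j)) ->
  exists u : nat -> nat, {homo u : i j / i < j} /\ forall k l, k < l -> R (u k) (u l).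
Proof.
move=> H; have [T TP] := choice (fun i => let: conj _ h := conj I (H (k0 + i) (leq_addr _ _)) in h).
pose fix u n := if n is m.+1 then (u m + T (u m)).+1 else 0.
pose u' n := k0 + u n.
have us n : u n < u n.+1 by rewrite /= ltnS leq_addr.
have umon : {homo u : i j / i < j} by apply: homo_ltn; [apply: ltn_trans|].
exists u'; split; first by move=> i j ij; rewrite ltn_add2l umon.
move=> k l kl; apply: TP; rewrite /u'.
have : u k.+1 <= u l.
  by move: kl; rewrite leq_eqVlt => /orP[/eqP->//|/umon/ltnW].
by rewrite /=; lia.
Qed.

(** * Construction of a stable ict-pattern *)

Section Converse.
Variables (L : language) (U : structure L).

(** Padding by a constant lets tuples of two different lengths share one sequence. *)
Lemma stable_pad (X X' : finType) (h : X' -> option X) (u0 : U) (a : nat -> X -> U) :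
  stable_sequence a ->
  stable_sequence (fun i x => if h x is Some y then a i y else u0).
Proof.
move=> sa; apply: at_most_stable => Y phi.
pose c0 : {u : U | setT u} := exist _ u0 I.
pose k (x : X' + Y) : (X + Y) + {u : U | setT u} := match x with
  inl x => if h x is Some y then inl (inl y) else inr c0 | inr y => inl (inr y) end.
have D := definable_subst k (definable_formula setT phi).
have [n Hn] := stable_at_most sa D; exists n => b; move: (Hn b).
suff E i : vcat (vcat (a i) b) sval \o k =
    vcat (fun x => if h x is Some y then a i y else u0) b.
  suff -> : [set i | sat (vcat (vcat (a i) b) sval \o k) phi] =
    [set i | sat (vcat (fun x => if h x is Some y then a i y else u0) b) phi] by [].
  by apply/funext => i; rewrite /= E.
by apply/funext => -[x|y] //=; case: (h x).
Qed.

Variables (X Y : finType) (a : nat -> X -> U) (b : nat -> Y -> U).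
Hypotheses (sa : stable_sequence a) (sb : stable_sequence b).
Variables (M : set U) (u0 : U).
Hypotheses (aM : forall i x, M (a i x)) (bM : forall j y, M (b j y)) (u0M : M u0).

Section Diagonal.
Variables (c : nat -> X -> U) (d : nat -> Y -> U).
Hypothesis Me : Morley_sequence M (tensor_limit a b) (fun i => vcat (c i) (d i)).
Variables (Z : finType) (phi : formula L ((X + Y)%type + Z)).

(* The terms of the two sequences are put in a single sequence
   [d 0, c 0, d 1, c 1, ..] of tuples indexed by [X + Y]. *)
Let pad_left (x : X -> U) : X + Y -> U := vcat x (fun=> u0).
Let pad_right (y : Y -> U) : X + Y -> U := vcat (fun=> u0) y.
Let ar (t : bool) i := if t then pad_left (a i) else pad_right (b i).
Let g n := if odd n then pad_left (c n./2) else pad_right (d n./2).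

(** Moving the terms of [d] along [f] changes only even positions of the merged sequence and
    preserves the kind of each term, so [generic_indiscernible] applies. *)
Lemma diagonal_permute N (f : nat -> nat) : injective f ->
  diagonalizable phi N c d -> diagonalizable phi N c (d \o f).
Proof.
move=> fI diag.
have st t : stable_sequence (ar t).
  case: t; rewrite /ar.
    have := stable_pad (fun z : X + Y => if z is inl x then Some x else None) u0 sa.
    suff -> : (fun i (x : X + Y) => if (if x is inl x then Some x else None) is Some y then a i y else u0) =
      (fun i => pad_left (a i)) by [].
    by apply/funext => i; apply/funext; case.
  have := stable_pad (fun z : X + Y => if z is inr x then Some x else None) u0 sb.
  suff -> : (fun i (x : X + Y) => if (if x is inr x then Some x else None) is Some y then b i y else u0) =
    (fun i => pad_right (b i)) by [].
  by apply/funext => i; apply/funext; case.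
have arM t i x : M (ar t i x) by case: t x => -[x|y] /=; first [exact: aM|exact: bM|exact: u0M].
(* For odd [n], the term of [d] of index [n./2] precedes that of [c]; hence the rounding up for
   [d]. *)
have gE n u : earlier g n u -> (M `|` (earlier c n./2 `|` earlier d (uphalf n))) u.
  move=> [j jn [[x|y] ->]]; rewrite /g; case: ifP => oj /=; try by left.
    by right; left; exists j./2; [lia|exists x].
  by right; right; exists j./2; [lia|exists y].
have Mg n P : definable (M `|` earlier g n) P ->
    eventual (fun i => P (ar (odd n) i)) -> P (g n).
  move=> D; rewrite /g /ar; case: ifP => on e.
    apply: (tensor_Morley_left sa sb aM Me (P := fun x => P (pad_left x))) => //.
    have D' : definable (M `|` (earlier c n./2 `|` earlier d n./2) `|` range (d n./2)) P.
      apply: definable_subset D => u [uM|/gE[uM|[h|[j jn [y ->]]]]].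
      - by left; left.
      - by left; left.
      - by left; right; left.
      - case: (ltnP j n./2) => h; first by left; right; right; exists j => //; exists y.
        right; exists y => //; suff -> : j = n./2 by [].
        by move: jn h; rewrite uphalf_half on; lia.
    apply: (definable_fix (V := X) (W := Y) (c := fun=> u0)) D'.
    by move=> _; left; left.
  apply: (tensor_Morley_right sa sb Me (P := fun x => P (pad_right x))) => //.
  have D' : definable (M `|` (earlier c n./2 `|` earlier d n./2)) P.
    apply: definable_subset D => u [uM|/gE[uM|h]]; [by left|by left|right].
    by move: h; rewrite uphalf_half on.
  pose k (x : X + Y) : Y + {u | (M `|` (earlier c n./2 `|` earlier d n./2)) u} :=
    if x is inr y then inl y else inr (exist _ u0 (or_introl u0M)).
  apply: eq_definable (definable_subst k D') => v; apply: (eq_iff P).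
  by apply/funext; case.
have cof n m : exists2 k, m <= k & odd k = odd n.
  by exists (odd n + m.*2); [lia|rewrite oddD odd_double addbF oddb].
have lim n P : definable setT P -> eventual (fun i => P (ar (odd n) i)) ->
    eventual (fun k => odd k = odd n -> P (g k)).
  have pull (h : nat -> Prop) : eventual h -> eventual (fun k => h k./2).
    by move=> [k0 H]; exists k0.*2 => k kk; apply: H; lia.
  move=> D; rewrite /ar; case on : (odd n) => e.
    have := eventual_left sa sb aM Me (P := fun x => P (pad_left x)) _ e.
    move=> /(_ _)/pull e'; apply: eventual_imp (e' _) _.
      exact: (definable_fix (V := X) (W := Y) (c := fun=> u0) (fun _ => I) D).
    by move=> k h ok; rewrite /g ok.
  have := eventual_right sa sb bM Me (P := fun x => P (pad_right x)) _ e.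
  move=> /(_ _)/pull e'; apply: eventual_imp (e' _) _.
    pose k (x : X + Y) : Y + {u : U | setT u} :=
      if x is inr y then inl y else inr (exist _ u0 I).
    apply: eq_definable (definable_subst k D) => v; apply: (eq_iff P).
    by apply/funext; case.
  by move=> k h ok; rewrite /g ok.
pose R (v : nat * (X + Y) -> U) := diagonalizable phi N (fun k x => v (k.*2.+1, inl x))
  (fun k y => v (k.*2, inr y)).
have sR : supported N.*2 R.
  have RR s s' : (forall k, k < N.*2 -> s k = s' k) -> R (flat s) -> R (flat s').
    move=> ss [z zP]; exists z => -[[k kN] [l lN]]; rewrite -zP /flat /= !ss //; lia.
  by move=> s s' ss; split; apply: RR => // k kN; rewrite ss.
pose v n := if odd n then n else (f n./2).*2.
have ov n : odd (v n) = odd n by rewrite /v; case: ifP => // on; rewrite odd_double.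
have Rid : R (flat (g \o id)).
  move: diag => [z zP]; exists z => kl; rewrite -zP.
  apply: (eq_iff (fun w => sat w phi)); apply/funext => -[[x|y]|//] /=;
  by rewrite /flat /= /g /= odd_double /= ?doubleK// uphalf_double.
have Rv : R (flat (g \o v)).
  apply: (generic_indiscernible st arM Mg cof lim _ sR _ _ _ Rid).
  - exact: definable_diagonalizable.
  - by move=> k l /andP[kl _] E; move: kl; rewrite E ltnn.
  - move=> k l /andP[kl _] E; have := ov k; rewrite E ov => okl.
    move: E; rewrite /v okl; case: ifP => ok; first by move=> E; move: kl; rewrite E ltnn.
    by move=> /double_inj/fI E; move: kl (odd_double_half k) (odd_double_half l); rewrite E okl; lia.
  - by move=> k _; rewrite ov.
move: Rv => [z zP]; exists z => kl; rewrite -zP.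
apply: (eq_iff (fun w => sat w phi)); apply/funext => -[[x|y]|//] /=;
by rewrite /flat /= /v /g /= !odd_double /= ?doubleK ?odd_double /= ?doubleK// uphalf_double.
Qed.

Lemma diagonal_ict_pattern :
  (forall N, diagonalizable phi N c d) -> stable_ict_pattern phi c d.
Proof.
move=> diag; split.
- exact: (stable_Morley sa aM (Morley_left sa sb aM Me)).
- exact: (stable_Morley sb bM (Morley_right sa sb Me)).
move=> f bf k F /choice[i /choice[j FE]].
have [f' fK f'K] := bf.
(* After the permutation, the term d_j stands at position [f' j], so [N] has to bound these
   positions as well as the [i s]. *)
pose N := (\max_(s < k) maxn (i s) (f' (j s))).+1.
have sN s : i s < N /\ f' (j s) < N.
  have : maxn (i s) (f' (j s)) < N by rewrite ltnS; apply: (leq_bigmax s).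
  by rewrite gtn_max => /andP[].
have [z zP] := diagonal_permute (can_inj fK) (diag N).
exists z => s; rewrite FE; have [iN jN] := sN s.
have := zP (Ordinal iN, Ordinal jN); rewrite /= f'K => E.
case: eqP => fij.
  by apply/sat_inst_xy/E/val_inj; rewrite /= -fij fK.
by move=> /sat_inst_xy/E[ij]; apply: fij; rewrite ij f'K.
Qed.

End Diagonal.

Lemma not_generically_stable_ict_pattern :
  ~ generically_stable_over M (tensor_limit a b) -> admits_stable_ict_pattern U.
Proof.
move=> ngs; apply: contrapT => nict; apply: ngs => e Me phi tphi.
apply: contrapT => /not_eventual nev; apply: nict.
have [Z [w [phi0 E]]] := inst_support phi.
have [nx nxP] := choice (fun k => let: ex_intro2 i ki ni := nev k in
  ex_intro (fun i => k <= i /\ ~ sat (vcat (e i) id) phi) i (conj ki ni)).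
(* The formula fails infinitely often along [e]; the subsequence of failures is again a Morley
   sequence. *)
have [u [um uP]] : exists u : nat -> nat, {homo u : i j / i < j} /\
    forall k, ~ sat (vcat (e (u k)) id) phi.
  pose fix u n := if n is m.+1 then nx (u m).+1 else nx 0.
  exists u; split; last by case=> [|k]; apply: (nxP _).2.
  by apply: homo_ltn; [apply: ltn_trans|move=> k; apply: (nxP _).1].
have := Morley_subseq um Me; set e1 := e \o u.
pose c i x := e1 i (inl x); pose d i y := e1 i (inr y).
have e1E : e1 = fun i => vcat (c i) (d i) by apply/funext => i; apply/funext; case.
rewrite e1E => Me1.
pose rho i j := sat (vcat (vcat (c i) (d j)) w) phi0.
have diagF k : ~ rho k k.
  have := uP k; rewrite E sat_inst.
  by have -> : e (u k) = vcat (c k) (d k) by rewrite -[LHS]/(e1 k) e1E.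
have D : definable setT (fun v : X + Y -> U => sat (vcat v w) phi0).
  exact: definable_sat.
have ev1 : eventual (fun j => eventual (fun i => rho i j)).
  apply: (eventual_tensor sa sb aM bM Me1 D).
  move: tphi; rewrite E => t; apply: eventual_imp t _ => j t.
  by apply: eventual_imp t _ => i; rewrite sat_inst.
have sd := stable_Morley sb bM (Morley_right sa sb Me1).
(* Stability of [d] exchanges the two limits, so the formula holds far from the diagonal on both
   sides. *)
have ev2 : eventual (fun i => eventual (fun j => rho i j)).
  have D' := definable_rename (fun x : X + Y => match x with
    inl x => inr x | inr y => inl y end) D.
  have [n Hn] := stable_at_most sd D'.
  apply: (eventual_swap (n := n)) ev1 => i.
  have := Hn (c i).
  suff -> : [set j | sat (vcat (vcat (d j) (c i) \o (fun x : X + Y => match x with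
    inl x => inr x | inr y => inl y end)) w) phi0] = [set j | rho i j] by [].
  apply/funext => j; rewrite /rho /=; congr sat; congr vcat.
  by apply/funext; case.
have [k0 H] := eventual_and ev1 ev2.
have [v [vm vP]] := increasing_homogeneous (R := fun i j => rho i j /\ rho j i) (k0 := k0)
  (fun i ki => let: conj h1 h2 := H i ki in eventual_and h2 h1).
have Me2 := Morley_subseq vm Me1.
(* Along the extracted subsequence [phi0] holds exactly off the diagonal, so its negation is
   diagonal with the single parameter [w]. *)
exists X, Y, Z, (Neg phi0), (c \o v), (d \o v).
apply: diagonal_ict_pattern => // N; exists w => -[k l] /=.
split=> [nr|-> /diagF//]; apply/val_inj => /=.
by case: (ltngtP k l) => // kl; case: nr; [case: (vP _ _ kl)|case: (vP _ _ kl)].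
Qed.

End Converse.

Theorem theorem4p8 (L : language) (T : set (sentence L)) (K : Type)
    (U : structure L) (hT : complete_theory T) (hU : monster K T U) :
  admits_stable_ict_pattern U <->
  exists (X Y : finType) (p : set (formula L (X + U)))
    (q : set (formula L (Y + U))),
    [/\ global_type p, global_type q,
        generically_stable K p, generically_stable K q
      & ~ generically_stable K (tensor K p q)].
Proof.
case: hU => _ hK hS _; split.
  move=> [X [Y [Z [phi [a [b pat]]]]]]; have [sa sb _] := pat.
  exists X, Y, (limit_type a), (limit_type b); split.
  - exact: global_limit_type.
  - exact: global_limit_type.
  - exact: generically_stable_limit_type.
  - exact: generically_stable_limit_type.
  - exact: ict_pattern_not_generically_stable pat.
move=> [X [Y [p [q [gp gq]]]]].
move=> /(generically_stable_limit hK hS gp)[a sa ->].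
move=> /(generically_stable_limit hK hS gq)[b sb ->].
rewrite (tensor_limitE hK hS sa sb) => ngs.
have [u0] := carrier_inhabited U.
(* The model contains both sequences and the padding element [u0]. *)
have [M sM Mabu] := small_model_through (U := U) hK
  (vcat (vcat (flat a) (flat b)) (fun _ : unit => u0)).
have aM i x : M (a i x) by apply: (Mabu (inl (inl (i, x)))).
have bM j y : M (b j y) by apply: (Mabu (inl (inr (j, y)))).
apply: (not_generically_stable_ict_pattern sa sb aM bM (Mabu (inr tt))) => gs.
by apply: ngs; exists M; split=> //; apply: invariant_tensor_limit.
Qed.
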